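(* Let $p \in (0,1)$ and $P = p + \frac1p$. (i) $\mathbf{X}_0(\mathcal{B}_p) = \{c_0\in\mathbb{C} : |c_0 - P^{-1}| \le P^{-1}\}$. For a function $\varphi(z)=c_0+c_1z+\cdots$ in $\mathcal{B}_p$, one has $c_0\in\partial\mathbf{X}_0(\mathcal{B}_p)$ if and only if $\varphi$ is an analytic automorphism of $\mathbb{D}$. (ii) $$\mathbf{X}_1(\mathcal{B}_p)=\Big\{(c_0,c_1)\in\mathbb{C}^2: \big| c_1 -(1-Pc_0+c_0^2) \big| \le P\big[P^{-2}-| c_0 - P^{-1}|^2\big]\Big\}.$$ In other words, a pair $(c_0,c_1)$ of complex numbers is contained in $\mathbf{X}_1(\mathcal{B}_p)$ if and only if $$c_0=P^{-1}(1-\sigma_0)\quad\text{and}\quad c_1=P^{-2}\big[1+(P^2-2)\sigma_0+\sigma_0^2\big]+P^{-1}(1-|\sigma_0|^2)\sigma_1$$ for some $\sigma_0,\sigma_1\in\overline{\mathbb{D}}$. Moreover, for a function $\varphi(z)=c_0+c_1z+\cdots$ in $\mathcal{B}_p$, one has $(c_0,c_1)\in\partial\mathbf{X}_1(\mathcal{B}_p)$ if and only if $\varphi$ is either an analytic automorphism of $\mathbb{D}$ or a Blaschke product of degree $2$.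
   Context: $\mathbb{D}=\{z\in\mathbb{C}:|z|<1\}$ is the open unit disk and $\overline{\mathbb{D}}$ its closure. For $p\in(0,1)$, $\mathcal{B}_p$ is the set of holomorphic maps $\varphi:\mathbb{D}\to\mathbb{D}$ with $\varphi(p)=p$. For a class $\mathcal{F}$ of analytic functions at the origin and $n\ge 0$, the coefficient body of order $n$ is $$\mathbf{X}_n(\mathcal{F})=\{(c_0,c_1,\dots,c_n)\in\mathbb{C}^{n+1}: \varphi(z)=c_0+c_1z+\dots+c_nz^n+O(z^{n+1}) \text{ as } z\to0 \text{ for some }\varphi\in\mathcal{F}\}.$$ $\partial$ denotes the topological boundary in $\mathbb{C}^{n+1}$ (that is, in $\mathbb{C}$ for $n=0$ and in $\mathbb{C}^2$ for $n=1$). *)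

(* Defs.v *)
From Stdlib Require Import Reals List.
From Coquelicot Require Import Coquelicot.
Open Scope R_scope.

Definition unit_disk (z : C) : Prop := Cmod z < 1.
Definition closed_unit_disk (z : C) : Prop := Cmod z <= 1.

(* Holomorphic self-maps of the disk are represented by total functions C -> C;
   their values off the disk are irrelevant.  [ex_derive] is taken here over
   the field C, so it is complex differentiability; as the disk is open,
   it only depends on the values on the disk. *)
Definition holomorphic_on_disk (phi : C -> C) : Prop :=
  forall z : C, unit_disk z -> ex_derive (K := C_AbsRing) (V := C_NormedModule) phi z.

Definition holomorphic_self_map (phi : C -> C) : Prop :=
  holomorphic_on_disk phi /\ (forall z : C, unit_disk z -> unit_disk (phi z)).

Definition B (p : R) (phi : C -> C) : Prop :=
  holomorphic_self_map phi /\ phi (RtoC p) = RtoC p.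

Definition disk_automorphism (phi : C -> C) : Prop :=
  holomorphic_self_map phi /\
  exists psi : C -> C, holomorphic_self_map psi /\
    (forall z : C, unit_disk z -> psi (phi z) = z /\ phi (psi z) = z).

(* The zeros are listed with multiplicity, so the degree is the length. *)
Definition blaschke_product (d : nat) (phi : C -> C) : Prop :=
  exists (zeta : C) (zeros : list C),
    Cmod zeta = 1 /\ length zeros = d /\ List.Forall unit_disk zeros /\
    forall z : C, unit_disk z ->
      phi z = (zeta * fold_right Cmult 1
                 (map (fun a => (z - a) / (1 - Cconj a * z)) zeros))%C.

(* C^(n+1) with its product topology, as a right-nested product: [Cspace 0] is
   C and [Cspace 1] is C * C, up to conversion. *)
Fixpoint Cspace (n : nat) : UniformSpace :=
  match n with
  | O => C_UniformSpace
  | S m => prod_UniformSpace C_UniformSpace (Cspace m)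
  end.

(* Horner form of c_0 + c_1 z + ... + c_n z^n. *)
Fixpoint coef_poly (n : nat) : Cspace n -> C -> C :=
  match n return Cspace n -> C -> C with
  | O => fun c _ => c
  | S m => fun c z => (fst c + z * coef_poly m (snd c) z)%C
  end.

(* phi(z) = c_0 + c_1 z + ... + c_n z^n + O(z^(n+1)) as z -> 0. *)
Definition has_expansion (n : nat) (phi : C -> C) (c : Cspace n) : Prop :=
  exists M : R,
    locally (T := C_UniformSpace) (RtoC 0) (fun z : C =>
      Cmod (phi z - coef_poly n c z) <= M * Cmod z ^ S n).

Definition coef_body (n : nat) (F : (C -> C) -> Prop) (c : Cspace n) : Prop :=
  exists phi : C -> C, F phi /\ has_expansion n phi c.

Definition boundary {T : UniformSpace} (A : T -> Prop) (x : T) : Prop :=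
  forall eps : posreal,
    (exists y : T, ball x eps y /\ A y) /\ (exists y : T, ball x eps y /\ ~ A y).

(* Main.v *)
Require Import Defs.
From Stdlib Require Import Reals List.
From Stdlib Require Import Lra Psatz Classical ClassicalEpsilon.
From Coquelicot Require Import Coquelicot.
Open Scope R_scope.

(** Write [mobius b z = (z - b) / (1 - conj b z)].  For [phi] in [B p], the map
    [mobius p (phi z)] vanishes at [p], so that Schwarz's lemma gives
    [mobius p (phi z) = mobius p z * g z] with [|g| <= 1] on the disk.  With
    [s = g 0], the Schwarz-Pick lemma at the origin gives in turn
    [g z = (s + z h z) / (1 + conj s * z h z)] with [|h| <= 1].  This is
    [B_parametrization]: [phi z = Phi p s (h z) z] for an explicit [Phi].
    Conversely every pair of constants [s], [h] in the closed disk produces an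
    element of [B p].  Expanding [Phi] at the origin ([Phi_expansion]) expresses
    [c0] through [s] and [c1] through [s] and [h 0], so that both coefficient
    bodies are images of closed disks.  The change of variables
    [sigma0 = mobius (p^2) s], [sigma1 = - h 0 * (a number of modulus 1)] turns
    these images into the formulas of the statement.

    A boundary point corresponds to [|s| = 1] or [|h 0| = 1].  By the strong
    maximum principle [strong_max] the function [g], respectively [h], is then
    constant: in the first case [phi] is conjugate by [mobius p] to a rotation, in
    the second one [mobius p z * g z] is a Blaschke product of degree two, hence so
    is [phi].  The converses compare [phi] with its inverse, respectively identify
    [h] from the explicit formula of a Blaschke product fixing [p].

    Everything rests on the maximum principle for functions that are merely
    complex differentiable.  It comes from the theorem of Goursat on a rectangle,
    applied to [w |-> f (exp w)]: the horizontal sides cancel by periodicity, so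
    that the mean of [f] over circles around the origin does not depend on the
    radius.  Only a bound on [f 0] is drawn from this; disk automorphisms carry it
    to the other points.  The quotients [g] and [h] are known to be continuous,
    but not differentiable, at the points where a division took place.  Instead of
    removing these singularities, the theory is developed for functions
    holomorphic off a finite set of exceptional points: if [f] is continuous at
    [e] then [f^n * (z - e)] is differentiable there, and large [n] make the extra
    factor harmless ([max_principle]).  The strong maximum principle in turn
    follows from the Schwarz-Pick inequality applied to [lam * f] with [lam] tending
    to 1. *)

(** * Goursat's theorem for Cauchy-Riemann pairs on a rectangle *)

(** Differentiability of [u + i v] at [(x0, y0)] with derivative [al + i be],
    written with real functions so that only real integrals are needed. *)
Definition cauchy_riemann_at (u v : R -> R -> R) (x0 y0 : R) : Prop :=
  exists al be : R, forall eps, 0 < eps -> exists del, 0 < del /\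
    forall x y, Rabs (x - x0) < del -> Rabs (y - y0) < del ->
      Rabs (u x y - u x0 y0 - (al * (x - x0) - be * (y - y0)))
        <= eps * (Rabs (x - x0) + Rabs (y - y0)) /\
      Rabs (v x y - v x0 y0 - (be * (x - x0) + al * (y - y0)))
        <= eps * (Rabs (x - x0) + Rabs (y - y0)).

Lemma linear_approx_continuous (f : R -> R) (x0 l : R) :
  (forall eps, 0 < eps -> exists del, 0 < del /\
     forall x, Rabs (x - x0) < del ->
       Rabs (f x - f x0 - l * (x - x0)) <= eps * Rabs (x - x0)) ->
  continuous f x0.
Proof.
intros H. apply continuity_pt_filterlim.
apply derivable_continuous_pt. exists l. intros eps Heps.
destruct (H (eps / 2)) as [del [Hd Hx]]; [lra|].
exists (mkposreal del Hd). simpl. intros h Hh0 Hh.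
specialize (Hx (x0 + h)). replace (x0 + h - x0) with h in Hx by ring.
specialize (Hx Hh).
replace ((f (x0 + h) - f x0) / h - l) with ((f (x0 + h) - f x0 - l * h) / h)
  by (field; assumption).
unfold Rdiv at 1. rewrite Rabs_mult, Rabs_inv.
assert (0 < Rabs h) by (apply Rabs_pos_lt; assumption).
apply Rmult_lt_reg_r with (Rabs h); [assumption|].
rewrite Rmult_assoc, Rinv_l by lra. nra.
Qed.

Lemma cauchy_riemann_continuous u v x0 y0 :
  cauchy_riemann_at u v x0 y0 ->
  continuous (fun y => u x0 y) y0 /\ continuous (fun x => v x y0) x0.
Proof.
intros (al & be & H); split.
- apply linear_approx_continuous with (- be). intros eps Heps.
  destruct (H eps Heps) as (del & Hd & Hxy). exists del; split; [assumption|].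
  intros y Hy. destruct (Hxy x0 y) as [Hu _]; try assumption.
  { rewrite Rminus_diag, Rabs_R0. assumption. }
  rewrite !Rminus_diag, Rabs_R0, Rplus_0_l in Hu.
  eapply Rle_trans; [|apply Hu]. right; f_equal; ring.
- apply linear_approx_continuous with be. intros eps Heps.
  destruct (H eps Heps) as (del & Hd & Hxy). exists del; split; [assumption|].
  intros x Hx. destruct (Hxy x y0) as [_ Hv]; try assumption.
  { rewrite Rminus_diag, Rabs_R0. assumption. }
  rewrite !Rminus_diag, Rabs_R0, Rplus_0_r in Hv.
  eapply Rle_trans; [|apply Hv]. right; f_equal; ring.
Qed.

(** The imaginary part of the integral of [u + i v] around the rectangle, with
    opposite sides grouped together: on each pair of sides the integrand is then
    close to a constant when [u + i v] is close to an affine function. *)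
Definition rect_integral (u v : R -> R -> R) (a b c d : R) : R :=
  RInt (fun x => v x c - v x d) a b + RInt (fun y => u b y - u a y) c d.

Definition regular_on (u v : R -> R -> R) (a b c d : R) : Prop :=
  a <= b /\ c <= d /\
  forall x y, a <= x <= b -> c <= y <= d -> cauchy_riemann_at u v x y.

Lemma ex_RInt_v u v a b c d x1 x2 y :
  regular_on u v a b c d -> a <= x1 -> x1 <= x2 -> x2 <= b -> c <= y <= d ->
  ex_RInt (fun x => v x y) x1 x2.
Proof.
intros (Hab & Hcd & H) H1 H2 H3 Hy. apply (ex_RInt_continuous (V := R_CompleteNormedModule)). intros x Hx.
rewrite Rmin_left, Rmax_right in Hx by lra.
apply (cauchy_riemann_continuous u v x y). apply H; lra.
Qed.

Lemma ex_RInt_u u v a b c d x y1 y2 :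
  regular_on u v a b c d -> a <= x <= b -> c <= y1 -> y1 <= y2 -> y2 <= d ->
  ex_RInt (fun y => u x y) y1 y2.
Proof.
intros (Hab & Hcd & H) Hx H1 H2 H3. apply (ex_RInt_continuous (V := R_CompleteNormedModule)). intros y Hy.
rewrite Rmin_left, Rmax_right in Hy by lra.
apply (cauchy_riemann_continuous u v x y). apply H; lra.
Qed.

Lemma RInt_sub (f g : R -> R) a b : ex_RInt f a b -> ex_RInt g a b ->
  RInt (fun x => f x - g x) a b = RInt f a b - RInt g a b.
Proof. exact (RInt_minus (V := R_CompleteNormedModule) f g a b). Qed.

Lemma RInt_split (f : R -> R) a b c : ex_RInt f a b -> ex_RInt f b c ->
  RInt f a c = RInt f a b + RInt f b c.
Proof. intros H1 H2. symmetry. apply (RInt_Chasles (V := R_CompleteNormedModule) f a b c H1 H2). Qed.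

Lemma rect_integral_quarter u v a b c d m n :
  regular_on u v a b c d -> a <= m <= b -> c <= n <= d ->
  rect_integral u v a b c d =
    rect_integral u v a m c n + rect_integral u v m b c n
    + (rect_integral u v a m n d + rect_integral u v m b n d).
Proof.
intros H Hm Hn. unfold rect_integral.
assert (Hv := fun x1 x2 y => ex_RInt_v u v a b c d x1 x2 y H).
assert (Hu := fun x y1 y2 => ex_RInt_u u v a b c d x y1 y2 H).
assert (Sv : forall x1 x2 y1 y2, a <= x1 -> x1 <= x2 -> x2 <= b ->
  c <= y1 <= d -> c <= y2 <= d -> RInt (fun x => v x y1 - v x y2) x1 x2 =
    RInt (fun x => v x y1) x1 x2 - RInt (fun x => v x y2) x1 x2)
  by (intros; apply RInt_sub; apply Hv; assumption).
assert (Su : forall x1 x2 y1 y2, a <= x1 <= b -> a <= x2 <= b ->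
  c <= y1 -> y1 <= y2 -> y2 <= d -> RInt (fun y => u x2 y - u x1 y) y1 y2 =
    RInt (fun y => u x2 y) y1 y2 - RInt (fun y => u x1 y) y1 y2)
  by (intros; apply RInt_sub; apply Hu; assumption).
rewrite !Sv, !Su by lra.
assert (Cv : forall y, c <= y <= d -> RInt (fun x => v x y) a b =
    RInt (fun x => v x y) a m + RInt (fun x => v x y) m b)
  by (intros; apply RInt_split; apply Hv; lra).
assert (Cu : forall x, a <= x <= b -> RInt (fun y => u x y) c d =
    RInt (fun y => u x y) c n + RInt (fun y => u x y) n d)
  by (intros; apply RInt_split; apply Hu; lra).
rewrite !Cv, !Cu by lra. ring.
Qed.

Lemma regular_on_sub u v a b c d a' b' c' d' :
  regular_on u v a b c d -> a <= a' -> a' <= b' -> b' <= b ->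
  c <= c' -> c' <= d' -> d' <= d -> regular_on u v a' b' c' d'.
Proof.
intros (Hab & Hcd & H) H1 H2 H3 H4 H5 H6. repeat split; try assumption.
intros x y Hx Hy. apply H; lra.
Qed.

Lemma RInt_near_const (f : R -> R) a b k e : a <= b -> ex_RInt f a b ->
  (forall x, a <= x <= b -> Rabs (f x - k) <= e) ->
  Rabs (RInt f a b - k * (b - a)) <= e * (b - a).
Proof.
intros Hab Hf Hk.
assert (E : RInt f a b - k * (b - a) = RInt (fun x => f x - k) a b).
{ rewrite RInt_sub; [|assumption|apply ex_RInt_const].
  rewrite RInt_const. unfold scal; simpl; unfold mult; simpl. ring. }
rewrite E, (Rmult_comm e). apply abs_RInt_le_const; try assumption.
apply (ex_RInt_minus (V := R_NormedModule)); [assumption|apply ex_RInt_const].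
Qed.

(** For an affine function the two integrals of [rect_integral] cancel exactly, because the
    same coefficient [al] governs both; what remains is the error of the affine
    approximation times the perimeter. *)
Lemma rect_integral_local u v x0 y0 : cauchy_riemann_at u v x0 y0 ->
  forall eps, 0 < eps -> exists del, 0 < del /\
    forall a b c d, regular_on u v a b c d -> a <= x0 <= b -> c <= y0 <= d ->
      b - a < del -> d - c < del ->
      Rabs (rect_integral u v a b c d) <= eps * ((b - a) + (d - c)) ^ 2.
Proof.
intros (al & be & H) eps Heps.
destruct (H (eps / 2)) as (del & Hd & Hxy); [lra|].
exists del; split; [assumption|].
intros a b c d Hr Hx0 Hy0 Hb Hd'.
assert (Hab := Hr). destruct Hab as (Hab & Hcd & _).
assert (Hbd : forall x y, a <= x <= b -> c <= y <= d ->
  Rabs (u x y - u x0 y0 - (al * (x - x0) - be * (y - y0)))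
    <= eps / 2 * ((b - a) + (d - c)) /\
  Rabs (v x y - v x0 y0 - (be * (x - x0) + al * (y - y0)))
    <= eps / 2 * ((b - a) + (d - c))).
{ intros x y Hx Hy.
  assert (Rabs (x - x0) <= b - a) by (apply Rabs_le; lra).
  assert (Rabs (y - y0) <= d - c) by (apply Rabs_le; lra).
  destruct (Hxy x y) as [Hu Hv]; try lra.
  split; (eapply Rle_trans; [eassumption|]); apply Rmult_le_compat_l; lra. }
assert (I1 : Rabs (RInt (fun x => v x c - v x d) a b - (al * (c - d)) * (b - a))
              <= eps * ((b - a) + (d - c)) * (b - a)).
{ apply RInt_near_const; [assumption| |].
  - apply (ex_RInt_minus (V := R_NormedModule)); eapply ex_RInt_v; eauto; lra.
  - intros x Hx. destruct (Hbd x c) as [_ H1]; try lra.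
    destruct (Hbd x d) as [_ H2]; try lra.
    apply Rabs_le. apply Rabs_le_between in H1. apply Rabs_le_between in H2. lra. }
assert (I2 : Rabs (RInt (fun y => u b y - u a y) c d - (al * (b - a)) * (d - c))
              <= eps * ((b - a) + (d - c)) * (d - c)).
{ apply RInt_near_const; [assumption| |].
  - apply (ex_RInt_minus (V := R_NormedModule)); eapply ex_RInt_u; eauto; lra.
  - intros y Hy. destruct (Hbd b y) as [H1 _]; try lra.
    destruct (Hbd a y) as [H2 _]; try lra.
    apply Rabs_le. apply Rabs_le_between in H1. apply Rabs_le_between in H2. lra. }
unfold rect_integral.
apply Rabs_le. apply Rabs_le_between in I1. apply Rabs_le_between in I2. nra.
Qed.

Definition bad_rect (u v : R -> R -> R) (eps : R) (r : R * R * (R * R)) : Prop :=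
  let '((a, b), (c, d)) := r in
  regular_on u v a b c d /\
  eps * ((b - a) + (d - c)) ^ 2 < Rabs (rect_integral u v a b c d).

Definition quarter_of (r r' : R * R * (R * R)) : Prop :=
  let '((a, b), (c, d)) := r in let '((a', b'), (c', d')) := r' in
  a <= a' /\ b' <= b /\ c <= c' /\ d' <= d /\
  b' - a' = (b - a) / 2 /\ d' - c' = (d - c) / 2.

(** If all four quarters satisfied the bound, so would the whole rectangle, since
    the square of the half perimeter is divided by four at each step. *)
Lemma bad_quarter u v eps r : bad_rect u v eps r ->
  exists r', bad_rect u v eps r' /\ quarter_of r r'.
Proof.
destruct r as [[a b] [c d]]. intros [Hr Hbad].
assert (Hab := Hr). destruct Hab as (Hab & Hcd & _).
set (m := (a + b) / 2). set (n := (c + d) / 2).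
rewrite (rect_integral_quarter u v a b c d m n Hr) in Hbad by (unfold m, n; lra).
assert (Hq : forall a' b' c' d', a <= a' -> a' <= b' -> b' <= b ->
  c <= c' -> c' <= d' -> d' <= d ->
  b' - a' = (b - a) / 2 -> d' - c' = (d - c) / 2 ->
  (exists r', bad_rect u v eps r' /\ quarter_of (a, b, (c, d)) r') \/
  Rabs (rect_integral u v a' b' c' d') <= eps * ((b - a) + (d - c)) ^ 2 / 4).
{ intros a' b' c' d' H1 H2 H3 H4 H5 H6 H7 H8.
  destruct (Rle_lt_dec (Rabs (rect_integral u v a' b' c' d'))
              (eps * ((b - a) + (d - c)) ^ 2 / 4)) as [Hle|Hlt]; [right; exact Hle|].
  left. exists (a', b', (c', d')). split; [split|].
  - apply (regular_on_sub u v a b c d); assumption.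
  - rewrite H7, H8. eapply Rle_lt_trans; [|exact Hlt]. right. field.
  - repeat split; assumption. }
destruct (Hq a m c n) as [?|Q1]; try (unfold m, n; lra); [assumption|].
destruct (Hq m b c n) as [?|Q2]; try (unfold m, n; lra); [assumption|].
destruct (Hq a m n d) as [?|Q3]; try (unfold m, n; lra); [assumption|].
destruct (Hq m b n d) as [?|Q4]; try (unfold m, n; lra); [assumption|].
exfalso.
apply Rabs_le_between in Q1, Q2, Q3, Q4.
revert Hbad. apply Rle_not_lt. apply Rabs_le. lra.
Qed.

Lemma nested_intervals (a b : nat -> R) :
  (forall n, a n <= a (S n)) -> (forall n, b (S n) <= b n) ->
  (forall n, a n <= b n) -> exists x, forall n, a n <= x <= b n.
Proof.
intros Ha Hb Hab.
assert (Ham : forall m n, (m <= n)%nat -> a m <= a n)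
  by (intros m n Hmn; apply tech9; assumption).
assert (Hbm : forall m n, (m <= n)%nat -> b n <= b m).
{ intros m n Hmn. induction Hmn; [lra|]. specialize (Hb m0). lra. }
assert (Hamb : forall m n, a m <= b n).
{ intros m n. destruct (Nat.le_ge_cases m n) as [H|H].
  - specialize (Ham m n H). specialize (Hab n). lra.
  - specialize (Hbm n m H). specialize (Hab m). lra. }
destruct (completeness (fun x => exists n, x = a n)) as [x [Hub Hlub]].
- exists (b O). intros y [n ->]. apply Hamb.
- exists (a O), O. reflexivity.
- exists x. intros n. split.
  + apply Hub. exists n. reflexivity.
  + apply Hlub. intros y [m ->]. apply Hamb.
Qed.

(** Otherwise, bad quarters chosen successively shrink to a point, where they
    contradict [rect_integral_local]. *)
Theorem goursat u v a b c d : regular_on u v a b c d ->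
  rect_integral u v a b c d = 0.
Proof.
intros Hr. apply NNPP. intros Hne.
set (J := Rabs (rect_integral u v a b c d)).
assert (HJ : 0 < J) by (apply Rabs_pos_lt; exact Hne).
set (s := ((b - a) + (d - c)) ^ 2).
assert (Hs : 0 <= s) by (apply pow2_ge_0).
set (eps := J / (2 * (s + 1))).
assert (Heps : 0 < eps) by (apply Rdiv_lt_0_compat; lra).
assert (H0 : bad_rect u v eps ((a, b), (c, d))).
{ split; [exact Hr|]. fold s. fold J. unfold eps.
  apply Rmult_lt_reg_r with (2 * (s + 1)); [lra|].
  replace (J / (2 * (s + 1)) * s * (2 * (s + 1))) with (J * s) by (field; lra).
  nra. }
set (next := fun r : {r | bad_rect u v eps r} =>
  let q := constructive_indefinite_description _ (bad_quarter u v eps (proj1_sig r) (proj2_sig r)) in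
  exist (bad_rect u v eps) (proj1_sig q) (proj1 (proj2_sig q))).
assert (Hnext : forall r, quarter_of (proj1_sig r) (proj1_sig (next r))).
{ intros r. unfold next. simpl.
  destruct (constructive_indefinite_description _ _) as [q [Hq1 Hq2]]. exact Hq2. }
set (seq := fun n => Nat.iter n next (exist _ _ H0)).
assert (Hseq : forall n, quarter_of (proj1_sig (seq n)) (proj1_sig (seq (S n))))
  by (intros n; apply Hnext).
assert (Hbad : forall n, bad_rect u v eps (proj1_sig (seq n)))
  by (intros n; apply (proj2_sig (seq n))).
set (an := fun n => fst (fst (proj1_sig (seq n)))).
set (bn := fun n => snd (fst (proj1_sig (seq n)))).
set (cn := fun n => fst (snd (proj1_sig (seq n)))).
set (dn := fun n => snd (snd (proj1_sig (seq n)))).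
assert (Hq : forall n, an n <= an (S n) /\ bn (S n) <= bn n /\
  cn n <= cn (S n) /\ dn (S n) <= dn n /\
  bn (S n) - an (S n) = (bn n - an n) / 2 /\
  dn (S n) - cn (S n) = (dn n - cn n) / 2).
{ intros n. specialize (Hseq n). unfold an, bn, cn, dn.
  destruct (proj1_sig (seq n)) as [[? ?] [? ?]].
  destruct (proj1_sig (seq (S n))) as [[? ?] [? ?]]. exact Hseq. }
assert (Hbd : forall n, regular_on u v (an n) (bn n) (cn n) (dn n) /\
  eps * ((bn n - an n) + (dn n - cn n)) ^ 2
    < Rabs (rect_integral u v (an n) (bn n) (cn n) (dn n))).
{ intros n. specialize (Hbad n). unfold an, bn, cn, dn.
  destruct (proj1_sig (seq n)) as [[? ?] [? ?]]. exact Hbad. }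
assert (Hw : forall n, bn n - an n = (b - a) / 2 ^ n /\ dn n - cn n = (d - c) / 2 ^ n).
{ induction n as [|n [IH1 IH2]]; [unfold an, bn, cn, dn; simpl; lra|].
  destruct (Hq n) as (_ & _ & _ & _ & E1 & E2). rewrite E1, E2, IH1, IH2. simpl.
  assert (2 ^ n <> 0) by (apply pow_nonzero; lra). split; field; assumption. }
destruct (nested_intervals an bn) as [x0 Hx0]; try (intros n; apply Hq).
{ intros n. apply (proj1 (Hbd n)). }
destruct (nested_intervals cn dn) as [y0 Hy0]; try (intros n; apply Hq).
{ intros n. apply (proj1 (Hbd n)). }
destruct (rect_integral_local u v x0 y0) with eps as (del & Hdel & Hloc).
{ apply (proj1 (Hbd O)); [apply Hx0 | apply Hy0]. }
{ exact Heps. }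
assert (Hn : exists n, ((b - a) + (d - c) + 1) / 2 ^ n < del).
{ set (w := (b - a) + (d - c) + 1).
  assert (Hw0 : 0 < w) by (destruct Hr as (? & ? & _); unfold w; lra).
  destruct (Pow_x_infinity 2) with (w / del + 1) as [N HN].
  { rewrite Rabs_right; lra. }
  exists N. specialize (HN N (Nat.le_refl N)).
  assert (0 < 2 ^ N) by (apply pow_lt; lra).
  rewrite Rabs_right in HN by lra.
  apply Rmult_lt_reg_r with (2 ^ N); [assumption|].
  unfold Rdiv. rewrite Rmult_assoc, Rinv_l by lra.
  assert (w = (w / del) * del) by (field; lra). nra. }
destruct Hn as [n Hn].
destruct (Hbd n) as [Hrn Hbn].
destruct (Hw n) as [W1 W2].
assert (Hp : 0 < / 2 ^ n) by (apply Rinv_0_lt_compat, pow_lt; lra).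
revert Hbn. apply Rle_not_lt. apply Hloc; try assumption.
- apply Hx0.
- apply Hy0.
- rewrite W1. destruct Hr as (? & ? & _). unfold Rdiv in *. nra.
- rewrite W2. destruct Hr as (? & ? & _). unfold Rdiv in *. nra.
Qed.

(** * Complex continuity and differentiability *)

Definition Cderiv (f : C -> C) (z l : C) : Prop :=
  is_derive (K := C_AbsRing) (V := C_NormedModule) f z l.
Definition Cdiff (f : C -> C) (z : C) : Prop :=
  ex_derive (K := C_AbsRing) (V := C_NormedModule) f z.
(** The uniform structure is the one given by the modulus, in which C is a
    topological ring, rather than the one of C as a product of two lines. *)
Definition Ccont (f : C -> C) (z : C) : Prop :=
  continuous (T := AbsRing_UniformSpace C_AbsRing)
             (U := AbsRing_UniformSpace C_AbsRing) f z.

Lemma Ccont_eps f z : Ccont f z <->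
  forall eps, 0 < eps -> exists del, 0 < del /\
    forall w, Cmod (w - z) < del -> Cmod (f w - f z) < eps.
Proof.
split.
- intros H eps Heps.
  destruct (H (fun y => Cmod (y - f z) < eps)) as [del Hdel].
  + exists (mkposreal eps Heps). intros y Hy. exact Hy.
  + exists del. split; [apply cond_pos|]. intros w Hw. apply (Hdel w). exact Hw.
- intros H P [eps HP]. destruct (H eps (cond_pos eps)) as (del & Hd & Hw).
  exists (mkposreal del Hd). intros y Hy. apply HP. apply Hw. exact Hy.
Qed.

Lemma Cderiv_eps f z l : Cderiv f z l <->
  forall eps, 0 < eps -> exists del, 0 < del /\
    forall w, Cmod (w - z) < del ->
      Cmod (f w - f z - (w - z) * l) <= eps * Cmod (w - z).
Proof.
split.
- intros [_ H] eps Heps.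
  destruct (H z (fun P HP => HP) (mkposreal eps Heps)) as [del Hdel].
  exists del. split; [apply cond_pos|]. intros w Hw. apply (Hdel w). exact Hw.
- intros H. split.
  + apply (is_linear_scal_l (K := C_AbsRing) (V := C_NormedModule) l).
  + intros x Hx eps.
    assert (E : z = x) by exact (is_filter_lim_locally_unique
      (V := AbsRing_NormedModule C_AbsRing) z x Hx).
    subst x.
    destruct (H eps (cond_pos eps)) as (del & Hd & Hw).
    exists (mkposreal del Hd). intros y Hy. apply Hw. exact Hy.
Qed.

(** The modules C over C and C over its own absolute-value ring carry the same
    scalar product and norm; the product rule is stated for the latter. *)
Lemma Cderiv_AbsRing f z l : Cderiv f z l <->
  is_derive (K := C_AbsRing) (V := AbsRing_NormedModule C_AbsRing) f z l.
Proof.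
split; intros [_ H]; split.
- apply (is_linear_scal_l (K := C_AbsRing) (V := AbsRing_NormedModule C_AbsRing) l).
- exact H.
- apply (is_linear_scal_l (K := C_AbsRing) (V := C_NormedModule) l).
- exact H.
Qed.

Lemma Cdiff_cont f z : Cdiff f z -> Ccont f z.
Proof.
intros [l Hl]. apply Cderiv_AbsRing in Hl.
exact (ex_derive_continuous (K := C_AbsRing) (V := AbsRing_NormedModule C_AbsRing)
         f z (ex_intro _ l Hl)).
Qed.

Lemma Ccont_const c z : Ccont (fun _ => c) z.
Proof.
exact (continuous_const (U := AbsRing_UniformSpace C_AbsRing)
  (V := AbsRing_UniformSpace C_AbsRing) c z). Qed.
Lemma Ccont_id z : Ccont (fun w => w) z.
Proof. exact (continuous_id (U := AbsRing_UniformSpace C_AbsRing) z). Qed.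
Lemma Ccont_plus f g z : Ccont f z -> Ccont g z -> Ccont (fun w => f w + g w)%C z.
Proof.
exact (continuous_plus (U := AbsRing_UniformSpace C_AbsRing)
  (V := AbsRing_NormedModule C_AbsRing) f g z). Qed.
Lemma Ccont_minus f g z : Ccont f z -> Ccont g z -> Ccont (fun w => f w - g w)%C z.
Proof.
exact (continuous_minus (U := AbsRing_UniformSpace C_AbsRing)
  (V := AbsRing_NormedModule C_AbsRing) f g z). Qed.
Lemma Ccont_mult f g z : Ccont f z -> Ccont g z -> Ccont (fun w => f w * g w)%C z.
Proof. exact (continuous_mult (U := AbsRing_UniformSpace C_AbsRing) (K := C_AbsRing) f g z). Qed.
Lemma Ccont_comp f g z : Ccont g z -> Ccont f (g z) -> Ccont (fun w => f (g w)) z.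
Proof.
exact (continuous_comp (U := AbsRing_UniformSpace C_AbsRing)
  (V := AbsRing_UniformSpace C_AbsRing) (W := AbsRing_UniformSpace C_AbsRing) g f z). Qed.

Lemma Cderiv_const c z : Cderiv (fun _ => c) z 0.
Proof. apply (is_derive_const (K := C_AbsRing) (V := C_NormedModule)). Qed.
Lemma Cderiv_id z : Cderiv (fun w => w) z 1.
Proof. apply Cderiv_AbsRing. apply (is_derive_id (K := C_AbsRing)). Qed.
Lemma Cderiv_minus f g z a b : Cderiv f z a -> Cderiv g z b ->
  Cderiv (fun w => f w - g w)%C z (a - b)%C.
Proof. exact (is_derive_minus (K := C_AbsRing) (V := C_NormedModule) f g z a b). Qed.
Lemma Cderiv_mult f g z a b : Cderiv f z a -> Cderiv g z b ->
  Cderiv (fun w => f w * g w)%C z (a * g z + f z * b)%C.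
Proof.
rewrite !Cderiv_AbsRing. intros H1 H2.
exact (is_derive_mult (K := C_AbsRing) f g z a b H1 H2 Cmult_comm).
Qed.
Lemma Cderiv_comp f g z a b : Cderiv f (g z) a -> Cderiv g z b ->
  Cderiv (fun w => f (g w)) z (b * a)%C.
Proof.
rewrite (Cderiv_AbsRing g). intros H1 H2.
exact (is_derive_comp (K := C_AbsRing) (V := C_NormedModule) f g z a b H1 H2).
Qed.

Lemma Cminus_0_iff (a b : C) : (a - b = 0)%C <-> a = b.
Proof.
split; intros H; [|subst; ring].
replace a with (a - b + b)%C by ring. rewrite H. ring.
Qed.

Lemma Cmod_minus_sym (a b : C) : Cmod (a - b) = Cmod (b - a).
Proof. rewrite <- Cmod_opp. f_equal. ring. Qed.

Lemma Cmod_triangle_minus (a b : C) : Cmod (a - b) <= Cmod a + Cmod b.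
Proof. rewrite <- (Cmod_opp b). apply Cmod_triangle. Qed.

Lemma Cmod_triangle_rev (a b : C) : Cmod a - Cmod b <= Cmod (a - b).
Proof.
assert (H := Cmod_triangle (a - b) b). replace (a - b + b)%C with a in H by ring. lra.
Qed.

Lemma Cmod_pos_lt (a : C) : a <> 0 -> 0 < Cmod a.
Proof. apply Cmod_gt_0. Qed.

Lemma Cnear_half (z w : C) : Cmod (w - z) < Cmod z / 2 -> Cmod z / 2 < Cmod w.
Proof.
intros H. assert (T := Cmod_triangle_rev z (z - w)).
replace (z - (z - w))%C with w in T by ring. rewrite Cmod_minus_sym in H. lra.
Qed.

Lemma Ccont_Cinv (z : C) : z <> 0 -> Ccont Cinv z.
Proof.
intros Hz. apply Ccont_eps. intros eps Heps.
assert (Mz := Cmod_pos_lt z Hz).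
assert (0 < eps * Cmod z ^ 2 / 2) by (apply Rdiv_lt_0_compat; [apply Rmult_lt_0_compat; nra|lra]).
exists (Rmin (Cmod z / 2) (eps * Cmod z ^ 2 / 2)).
split; [apply Rmin_pos; lra|]. intros w Hw.
assert (H1 : Cmod (w - z) < Cmod z / 2) by (eapply Rlt_le_trans; [exact Hw|apply Rmin_l]).
assert (H2 : Cmod (w - z) < eps * Cmod z ^ 2 / 2) by (eapply Rlt_le_trans; [exact Hw|apply Rmin_r]).
apply Cnear_half in H1.
assert (w <> 0) by (apply Cmod_gt_0; lra).
replace (/ w - / z)%C with (- (w - z) / (w * z))%C by (field; split; assumption).
rewrite Cmod_div, Cmod_opp, Cmod_mult by (apply Cmult_neq_0; assumption).
apply Rmult_lt_reg_r with (Cmod w * Cmod z); [nra|].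
unfold Rdiv. rewrite Rmult_assoc, Rinv_l by nra.
assert (eps * Cmod z * (Cmod w - Cmod z / 2) > 0) by (apply Rmult_lt_0_compat; nra). nra.
Qed.

Lemma Cderiv_Cinv (z : C) : z <> 0 -> Cderiv Cinv z (- / (z * z))%C.
Proof.
intros Hz. apply Cderiv_eps. intros eps Heps.
assert (Mz := Cmod_pos_lt z Hz).
assert (Mz3 : 0 < Cmod z ^ 3) by (apply pow_lt; assumption).
assert (0 < eps * Cmod z ^ 3 / 2) by nra.
exists (Rmin (Cmod z / 2) (eps * Cmod z ^ 3 / 2)).
split; [apply Rmin_pos; lra|]. intros w Hw.
assert (H1 : Cmod (w - z) < Cmod z / 2) by (eapply Rlt_le_trans; [exact Hw|apply Rmin_l]).
assert (H2 : Cmod (w - z) < eps * Cmod z ^ 3 / 2) by (eapply Rlt_le_trans; [exact Hw|apply Rmin_r]).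
apply Cnear_half in H1.
assert (w <> 0) by (apply Cmod_gt_0; lra).
replace (/ w - / z - (w - z) * - / (z * z))%C
  with ((w - z) / (w * (z * z)) * (w - z))%C by (field; split; assumption).
rewrite Cmod_mult. apply Rmult_le_compat_r; [apply Cmod_ge_0|].
assert (z * z <> 0)%C by (apply Cmult_neq_0; assumption).
rewrite Cmod_div, !Cmod_mult by (apply Cmult_neq_0; assumption).
assert (0 < Cmod z * Cmod z) by nra.
apply Rmult_le_reg_r with (Cmod w * (Cmod z * Cmod z)); [nra|].
unfold Rdiv. rewrite Rmult_assoc, Rinv_l by nra.
assert (eps * (Cmod z * Cmod z) * (Cmod w - Cmod z / 2) > 0) by (apply Rmult_lt_0_compat; nra). nra.
Qed.

Lemma Ccont_div f g z : Ccont f z -> Ccont g z -> g z <> 0 ->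
  Ccont (fun w => f w / g w)%C z.
Proof.
intros Hf Hg Hz. apply (Ccont_mult f (fun w => / g w)%C); [exact Hf|].
apply (Ccont_comp Cinv g); [exact Hg|]. apply Ccont_Cinv. exact Hz.
Qed.

Lemma Cdiff_const c z : Cdiff (fun _ => c) z.
Proof. eexists. apply Cderiv_const. Qed.
Lemma Cdiff_id z : Cdiff (fun w => w) z.
Proof. eexists. apply Cderiv_id. Qed.
Lemma Cdiff_minus f g z : Cdiff f z -> Cdiff g z -> Cdiff (fun w => f w - g w)%C z.
Proof. intros [a Ha] [b Hb]. eexists. apply Cderiv_minus; eassumption. Qed.
Lemma Cdiff_mult f g z : Cdiff f z -> Cdiff g z -> Cdiff (fun w => f w * g w)%C z.
Proof. intros [a Ha] [b Hb]. eexists. apply Cderiv_mult; eassumption. Qed.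
Lemma Cdiff_comp f g z : Cdiff f (g z) -> Cdiff g z -> Cdiff (fun w => f (g w)) z.
Proof. intros [a Ha] [b Hb]. eexists. apply Cderiv_comp; eassumption. Qed.
Lemma Cdiff_div f g z : Cdiff f z -> Cdiff g z -> g z <> 0 ->
  Cdiff (fun w => f w / g w)%C z.
Proof.
intros Hf Hg Hz. apply (Cdiff_mult f (fun w => / g w)%C); [exact Hf|].
apply (Cdiff_comp Cinv g); [|exact Hg]. eexists. apply Cderiv_Cinv. exact Hz.
Qed.
Lemma Cdiff_pow f n z : Cdiff f z -> Cdiff (fun w => f w ^ n)%C z.
Proof.
intros Hf. induction n as [|n IH]; simpl; [apply Cdiff_const|].
apply (Cdiff_mult f (fun w => f w ^ n)%C); assumption.
Qed.

Lemma Cdiff_local f g z del : 0 < del ->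
  (forall w, Cmod (w - z) < del -> f w = g w) -> Cdiff f z -> Cdiff g z.
Proof.
intros Hd H [l Hl]. exists l. apply Cderiv_eps. intros eps Heps.
destruct (proj1 (Cderiv_eps f z l) Hl eps Heps) as (d' & Hd' & Hw).
exists (Rmin del d'). split; [apply Rmin_pos; assumption|]. intros w Hwz.
rewrite <- (H w), <- (H z).
- apply Hw. eapply Rlt_le_trans; [exact Hwz|apply Rmin_r].
- rewrite (proj2 (Cminus_0_iff z z) eq_refl), Cmod_0. exact Hd.
- eapply Rlt_le_trans; [exact Hwz|apply Rmin_l].
Qed.

Lemma Ccont_local f g z del : 0 < del ->
  (forall w, Cmod (w - z) < del -> f w = g w) -> Ccont f z -> Ccont g z.
Proof.
intros Hd H Hl. apply Ccont_eps. intros eps Heps.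
destruct (proj1 (Ccont_eps f z) Hl eps Heps) as (d' & Hd' & Hw).
exists (Rmin del d'). split; [apply Rmin_pos; assumption|]. intros w Hwz.
rewrite <- (H w), <- (H z).
- apply Hw. eapply Rlt_le_trans; [exact Hwz|apply Rmin_r].
- rewrite (proj2 (Cminus_0_iff z z) eq_refl), Cmod_0. exact Hd.
- eapply Rlt_le_trans; [exact Hwz|apply Rmin_l].
Qed.

(** Caratheodory's form of differentiability: the slope function extends
    continuously.  It provides the quotient in the division lemma below. *)
Lemma Cdiff_slope f z : Cdiff f z ->
  exists q, Ccont q z /\ (forall w : C, (f w - f z = (w - z) * q w)%C) /\
    (forall w : C, w <> z -> (q w = (f w - f z) / (w - z))%C).
Proof.
intros [l Hl].
exists (fun w => if excluded_middle_informative (w = z) then l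
                 else ((f w - f z) / (w - z))%C).
assert (Hw : forall w, w <> z -> (w - z <> 0)%C)
  by (intros w Hne E; apply Hne, Cminus_0_iff, E).
split; [|split].
- apply Ccont_eps. intros eps Heps.
  destruct (proj1 (Cderiv_eps f z l) Hl (eps / 2)) as (del & Hd & H); [lra|].
  exists del. split; [exact Hd|]. intros w Hwd.
  destruct (excluded_middle_informative (z = z)) as [_|n]; [|destruct n; reflexivity].
  destruct (excluded_middle_informative (w = z)) as [_|n].
  + rewrite (proj2 (Cminus_0_iff l l) eq_refl), Cmod_0. exact Heps.
  + specialize (Hw w n).
    replace ((f w - f z) / (w - z) - l)%C with ((f w - f z - (w - z) * l) / (w - z))%C
      by (field; exact Hw).
    rewrite Cmod_div by exact Hw.
    assert (0 < Cmod (w - z)) by (apply Cmod_pos_lt; exact Hw).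
    specialize (H w Hwd).
    apply Rmult_lt_reg_r with (Cmod (w - z)); [assumption|].
    unfold Rdiv. rewrite Rmult_assoc, Rinv_l by lra. nra.
- intros w. destruct (excluded_middle_informative (w = z)) as [E|n]; [subst w|].
  + ring.
  + field. apply Hw, n.
- intros w n. destruct (excluded_middle_informative (w = z)) as [?|_]; [contradiction|reflexivity].
Qed.

(** In particular a continuous function multiplied by [w - z] is differentiable
    at [z], whatever its regularity there. *)
Lemma Cdiff_of_slope f q z : Ccont q z ->
  (forall w : C, (f w - f z = (w - z) * q w)%C) -> Cdiff f z.
Proof.
intros Hq H. exists (q z). apply Cderiv_eps. intros eps Heps.
destruct (proj1 (Ccont_eps q z) Hq eps Heps) as (del & Hd & Hw).
exists del. split; [exact Hd|]. intros w Hwd. rewrite H.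
replace ((w - z) * q w - (w - z) * q z)%C with ((q w - q z) * (w - z))%C by ring.
rewrite Cmod_mult. apply Rmult_le_compat_r; [apply Cmod_ge_0|].
left. apply Hw, Hwd.
Qed.

(** * The modulus at the centre of a disk *)

Lemma Cmod_le_sum (z : C) : Cmod z <= Rabs (fst z) + Rabs (snd z).
Proof.
unfold Cmod. rewrite <- (Rabs_pos_eq (Rabs (fst z) + Rabs (snd z))).
2:{ assert (A := Rabs_pos (fst z)). assert (B := Rabs_pos (snd z)). lra. }
rewrite <- sqrt_Rsqr_abs. apply sqrt_le_1_alt. unfold Rsqr.
rewrite <- (pow2_abs (fst z)), <- (pow2_abs (snd z)).
assert (A := Rabs_pos (fst z)). assert (B := Rabs_pos (snd z)). nra.
Qed.

Lemma Rabs_fst_le (z : C) : Rabs (fst z) <= Cmod z.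
Proof. exact (re_le_Cmod z). Qed.
Lemma Rabs_snd_le (z : C) : Rabs (snd z) <= Cmod z.
Proof. eapply Rle_trans; [apply Rmax_r|apply Rmax_Cmod]. Qed.

Lemma Cdiff_cauchy_riemann (h : C -> C) x0 y0 : Cdiff h (x0, y0) ->
  cauchy_riemann_at (fun x y => fst (h (x, y))) (fun x y => snd (h (x, y))) x0 y0.
Proof.
intros [[al be] Hl]. exists al, be. intros eps Heps.
destruct (proj1 (Cderiv_eps _ _ _) Hl eps Heps) as (del & Hd & Hw).
exists (del / 2). split; [lra|]. intros x y Hx Hy.
assert (Hle := Cmod_le_sum ((x, y) - (x0, y0))%C). simpl in Hle.
fold (x - x0) (y - y0) in Hle.
specialize (Hw (x, y)).
assert (Hlt : Cmod ((x, y) - (x0, y0)) < del) by lra.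
specialize (Hw Hlt).
assert (Hb : eps * Cmod ((x, y) - (x0, y0)) <= eps * (Rabs (x - x0) + Rabs (y - y0)))
  by (apply Rmult_le_compat_l; lra).
split.
- eapply Rle_trans; [|exact Hb]. eapply Rle_trans; [|exact Hw].
  eapply Rle_trans; [|apply Rabs_fst_le]. right. f_equal. simpl. ring.
- eapply Rle_trans; [|exact Hb]. eapply Rle_trans; [|exact Hw].
  eapply Rle_trans; [|apply Rabs_snd_le]. right. f_equal. simpl. ring.
Qed.

Definition Cexp (w : C) : C := (exp (fst w) * cos (snd w), exp (fst w) * sin (snd w)).

Lemma Cexp_plus a b : Cexp (a + b)%C = (Cexp a * Cexp b)%C.
Proof.
unfold Cexp. simpl. rewrite exp_plus, cos_plus, sin_plus.
unfold Cmult; simpl. f_equal; ring.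
Qed.

Lemma Cmod_Cexp w : Cmod (Cexp w) = exp (fst w).
Proof.
unfold Cmod, Cexp. simpl fst; simpl snd.
replace ((exp (fst w) * cos (snd w)) ^ 2 + (exp (fst w) * sin (snd w)) ^ 2)
  with (Rsqr (exp (fst w)) * (Rsqr (sin (snd w)) + Rsqr (cos (snd w)))) by (unfold Rsqr; ring).
rewrite sin2_cos2, Rmult_1_r. apply sqrt_Rsqr. left. apply exp_pos.
Qed.

Lemma derivable_pt_lim_linear f l : derivable_pt_lim f 0 l ->
  forall eps, 0 < eps -> exists del, 0 < del /\
    forall x, Rabs x < del -> Rabs (f x - f 0 - l * x) <= eps * Rabs x.
Proof.
intros H eps Heps. destruct (H eps Heps) as [del Hd].
exists del. split; [apply cond_pos|]. intros x Hx.
destruct (Req_dec x 0) as [->|Hx0].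
- rewrite Rmult_0_r, !Rminus_diag, Rabs_R0. lra.
- specialize (Hd x Hx0 Hx). rewrite Rplus_0_l in Hd.
  replace (f x - f 0 - l * x) with (((f x - f 0) / x - l) * x) by (field; assumption).
  rewrite Rabs_mult. apply Rmult_le_compat_r; [apply Rabs_pos|lra].
Qed.

Lemma Cderiv_Cexp_0 : Cderiv Cexp 0 1.
Proof.
apply Cderiv_eps. intros eps Heps.
(* The two components contribute errors of at most [4 e |w|] and [4 e |w|]. *)
set (e := eps / 10). assert (He : 0 < e) by (unfold e; lra).
assert (D1 : derivable_pt_lim exp 0 1) by apply derivable_pt_lim_exp_0.
assert (D2 : derivable_pt_lim sin 0 1).
{ replace 1 with (cos 0) by apply cos_0. apply derivable_pt_lim_sin. }
assert (D3 : derivable_pt_lim cos 0 0).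
{ replace 0 with (- sin 0) at 2 by (rewrite sin_0; ring). apply derivable_pt_lim_cos. }
destruct (derivable_pt_lim_linear _ _ D1 e He) as (d1 & P1 & E1).
destruct (derivable_pt_lim_linear _ _ D2 e He) as (d2 & P2 & E2).
destruct (derivable_pt_lim_linear _ _ D3 e He) as (d3 & P3 & E3).
rewrite exp_0 in E1. rewrite sin_0 in E2. rewrite cos_0 in E3.
assert (P4 := Rlt_0_1).
exists (Rmin (Rmin d1 d2) (Rmin (Rmin d3 1) (e / (1 + e)))).
assert (P5 : 0 < e / (1 + e)) by (apply Rdiv_lt_0_compat; lra).
split; [repeat apply Rmin_pos; assumption|].
intros w Hw. replace (w - 0)%C with w in * by ring.
assert (Hx := Rabs_fst_le w). assert (Hy := Rabs_snd_le w).
assert (Hw1 : Cmod w < d1 /\ Cmod w < d2 /\ Cmod w < d3 /\ Cmod w < 1 /\ Cmod w < e / (1 + e)).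
{ revert Hw. unfold Rmin. repeat destruct Rle_dec; intros; repeat split; lra. }
destruct Hw1 as (W1 & W2 & W3 & W4 & W5). clear Hw.
eapply Rle_trans; [apply Cmod_le_sum|].
destruct w as [x y]. simpl in Hx, Hy. unfold Cexp; simpl.
rewrite exp_0, cos_0, sin_0.
specialize (E1 x). specialize (E2 y). specialize (E3 y).
assert (A1 : Rabs (exp x - 1 - 1 * x) <= e * Rabs x) by (apply E1; lra).
assert (A2 : Rabs (sin y - 0 - 1 * y) <= e * Rabs y) by (apply E2; lra).
assert (A3 : Rabs (cos y - 1 - 0 * y) <= e * Rabs y) by (apply E3; lra).
clear E1 E2 E3.
assert (A4 : Rabs (exp x) <= 3).
{ rewrite Rabs_pos_eq by (left; apply exp_pos).
  eapply Rle_trans; [|apply exp_le_3]. left. apply exp_increasing.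
  apply Rabs_def2 with (a := 1). lra. }
assert (A5 : Rabs (exp x - 1) <= e).
{ replace (exp x - 1) with ((exp x - 1 - 1 * x) + x) by ring.
  eapply Rle_trans; [apply Rabs_triang|].
  assert (Rabs x < e / (1 + e)) by lra.
  assert (E : (1 + e) * (e / (1 + e)) = e) by (field; lra). nra. }
assert (B1 : Rabs (exp x * cos y + - (1 * 1) + - ((x + - 0) * 1 - (y + - 0) * 0))
             <= 3 * (e * Rabs y) + e * Rabs x).
{ replace (exp x * cos y + - (1 * 1) + - ((x + - 0) * 1 - (y + - 0) * 0))
    with (exp x * (cos y - 1 - 0 * y) + (exp x - 1 - 1 * x)) by ring.
  eapply Rle_trans; [apply Rabs_triang|]. rewrite Rabs_mult.
  apply Rplus_le_compat; [|assumption].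
  apply Rmult_le_compat; try apply Rabs_pos; assumption. }
assert (B2 : Rabs (exp x * sin y + - (1 * 0) + - ((x + - 0) * 0 + (y + - 0) * 1))
             <= 3 * (e * Rabs y) + e * Rabs y).
{ replace (exp x * sin y + - (1 * 0) + - ((x + - 0) * 0 + (y + - 0) * 1))
    with (exp x * (sin y - 0 - 1 * y) + (exp x - 1) * y) by ring.
  eapply Rle_trans; [apply Rabs_triang|]. rewrite !Rabs_mult.
  apply Rplus_le_compat.
  - apply Rmult_le_compat; try apply Rabs_pos; assumption.
  - apply Rmult_le_compat_r; [apply Rabs_pos|assumption]. }
assert (eps = 10 * e) by (unfold e; field).
assert (B3 : e * Rabs x <= e * Cmod (x, y)) by (apply Rmult_le_compat_l; lra).
assert (B4 : e * Rabs y <= e * Cmod (x, y)) by (apply Rmult_le_compat_l; lra).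
assert (0 <= e * Cmod (x, y)) by (apply Rmult_le_pos; [lra|apply Cmod_ge_0]).
match type of B1 with Rabs ?a <= _ => match goal with |- Rabs ?b + _ <= _ =>
  replace b with a by ring end end.
match type of B2 with Rabs ?a <= _ => match goal with |- _ + Rabs ?b <= _ =>
  replace b with a by ring end end.
match goal with H : eps = _ |- _ => rewrite H end. lra.
Qed.

Lemma Cdiff_Cexp w : Cdiff Cexp w.
Proof.
apply (Cdiff_local (fun z => Cexp w * Cexp (z - w))%C _ w 1 Rlt_0_1).
{ intros z _. rewrite <- Cexp_plus. f_equal. ring. }
apply (Cdiff_mult (fun _ => Cexp w) (fun z => Cexp (z - w))); [apply Cdiff_const|].
apply (Cdiff_comp Cexp (fun z => z - w)%C).
- replace (w - w)%C with (RtoC 0) by ring. eexists. apply Cderiv_Cexp_0.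
- apply (Cdiff_minus (fun z => z) (fun _ => w)); [apply Cdiff_id|apply Cdiff_const].
Qed.

(** On the rectangle [[a, b] x [0, 2 PI]] the function [w |-> f (exp w)] is
    holomorphic, and its horizontal sides contribute nothing by periodicity.
    Hence the means of [Re f] over the circles of radii [exp a] and [exp b = r]
    agree, and the former is close to [Re (f 0)] when [a] is very negative. *)
Lemma Re_center_le (f : C -> C) (r M : R) : holomorphic_on_disk f ->
  0 < r < 1 -> (forall z, Cmod z = r -> Cmod (f z) <= M) -> Re (f 0) <= M.
Proof.
intros Hf Hr HM. apply Rnot_lt_le. intros Hlt.
set (eta := (Re (f 0) - M) / 2). assert (Heta : 0 < eta) by (unfold eta; lra).
destruct (proj1 (Ccont_eps f 0)) with eta as (del & Hd & Hw).
{ apply Cdiff_cont, Hf. unfold unit_disk. rewrite Cmod_0. lra. }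
{ exact Heta. }
set (b := ln r). set (a := Rmin b (ln (del / 2))).
assert (Hab : a <= b) by apply Rmin_l.
assert (Hb0 : b < 0) by (unfold b; rewrite <- ln_1; apply ln_increasing; lra).
assert (Hda : exp a < del).
{ assert (E : exp (ln (del / 2)) = del / 2) by (apply exp_ln; lra).
  assert (a <= ln (del / 2)) by apply Rmin_r.
  assert (exp a <= exp (ln (del / 2))).
  { destruct H as [H| ->]; [left; apply exp_increasing, H|right; reflexivity]. }
  lra. }
set (h := fun w => f (Cexp w)).
set (u := fun x y => fst (h (x, y))). set (v := fun x y => snd (h (x, y))).
assert (Hreg : regular_on u v a b 0 (2 * PI)).
{ split; [exact Hab|]. split; [assert (P := PI_RGT_0); lra|].
  intros x y Hx _. apply Cdiff_cauchy_riemann. unfold h.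
  apply (Cdiff_comp f Cexp); [|apply Cdiff_Cexp].
  apply Hf. unfold unit_disk. rewrite Cmod_Cexp. simpl.
  rewrite <- exp_0. apply exp_increasing. lra. }
assert (G := goursat u v a b 0 (2 * PI) Hreg). unfold rect_integral in G.
assert (Hper : forall x, v x 0 - v x (2 * PI) = 0).
{ intros x. unfold v, h, Cexp. simpl. rewrite cos_2PI, sin_2PI, cos_0, sin_0. ring. }
rewrite (RInt_ext _ (fun _ => 0)) in G by (intros x _; apply Hper).
rewrite RInt_const in G. unfold scal in G; simpl in G; unfold mult in G; simpl in G.
assert (P := PI_RGT_0).
assert (Hle : RInt (fun y => u b y - u a y) 0 (2 * PI) <= RInt (fun _ => - eta) 0 (2 * PI)).
{ apply RInt_le; [lra| |apply ex_RInt_const|].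
  - apply (ex_RInt_minus (V := R_NormedModule)); eapply ex_RInt_u; eauto; lra.
  - intros y _.
    assert (U1 : u b y <= M).
    { eapply Rle_trans; [apply Rle_abs|]. eapply Rle_trans; [apply Rabs_fst_le|].
      apply HM. rewrite Cmod_Cexp. simpl. apply exp_ln. lra. }
    assert (U2 : Rabs (u a y - Re (f 0)) < eta).
    { eapply Rle_lt_trans; [|apply (Hw (Cexp (a, y)))].
      - eapply Rle_trans; [|apply Rabs_fst_le]. right. reflexivity.
      - replace (Cexp (a, y) - 0)%C with (Cexp (a, y)) by ring.
        rewrite Cmod_Cexp. exact Hda. }
    apply Rabs_def2 in U2. unfold eta in *. lra. }
rewrite RInt_const in Hle. unfold scal in Hle; simpl in Hle; unfold mult in Hle; simpl in Hle.
nra.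
Qed.

(** Rotating [f] by the conjugate of [f 0] makes its value at the centre real, so
    that the bound on the real part is a bound on the modulus. *)
Lemma Cmod_center_le (f : C -> C) (r M : R) : holomorphic_on_disk f ->
  0 < r < 1 -> (forall z, Cmod z = r -> Cmod (f z) <= M) -> Cmod (f 0) <= M.
Proof.
intros Hf Hr HM.
destruct (Req_dec (Cmod (f 0)) 0) as [E|Hne].
{ rewrite E. eapply Rle_trans; [apply (Cmod_ge_0 (f r))|]. apply HM.
  rewrite Cmod_R, Rabs_pos_eq; lra. }
assert (Hpos : 0 < Cmod (f 0)) by (assert (T := Cmod_ge_0 (f 0)); lra).
assert (H : Re (Cconj (f 0) * f 0) <= Cmod (f 0) * M).
{ apply (Re_center_le (fun z => Cconj (f 0) * f z)%C r); [|exact Hr|].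
  - intros z Hz. apply (Cdiff_mult (fun _ => Cconj (f 0)) f); [apply Cdiff_const|apply Hf, Hz].
  - intros z Hz. rewrite Cmod_mult, Cmod_conj. apply Rmult_le_compat_l; [lra|apply HM, Hz]. }
rewrite Cmult_comm, <- Cmod2_conj in H. simpl in H.
apply Rmult_le_reg_l with (Cmod (f 0)); lra.
Qed.

(** * Disk automorphisms and the maximum principle *)

Lemma Cmod_sqr_conj (z : C) : RtoC (Cmod z ^ 2) = (z * Cconj z)%C.
Proof. rewrite <- Cmod2_conj. reflexivity. Qed.

Lemma Cmod_lt_sqr (a b : C) : Cmod a ^ 2 < Cmod b ^ 2 -> Cmod a < Cmod b.
Proof.
intros H. assert (Ha := Cmod_ge_0 a). assert (Hb := Cmod_ge_0 b). nra.
Qed.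

Lemma Cmod_le_sqr (a b : C) : Cmod a ^ 2 <= Cmod b ^ 2 -> Cmod a <= Cmod b.
Proof.
intros H. assert (Ha := Cmod_ge_0 a). assert (Hb := Cmod_ge_0 b). nra.
Qed.

Lemma C1_minus_neq_0 (w : C) : Cmod w < 1 -> (1 - w)%C <> 0.
Proof.
intros H E. apply (proj1 (Cminus_0_iff _ _)) in E. rewrite <- E, Cmod_1 in H. lra.
Qed.

Lemma C1_plus_neq_0 (w : C) : Cmod w < 1 -> (1 + w)%C <> 0.
Proof.
intros H. replace (1 + w)%C with (1 - - w)%C by ring. apply C1_minus_neq_0.
rewrite Cmod_opp. exact H.
Qed.

Lemma Cmod_conj_mult_lt (a b : C) : Cmod a <= 1 -> Cmod b < 1 ->
  Cmod (Cconj a * b) < 1.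
Proof.
intros Ha Hb. rewrite Cmod_mult, Cmod_conj.
assert (A := Cmod_ge_0 a). assert (B := Cmod_ge_0 b). nra.
Qed.

Lemma Cmod_mult_conj_lt (a b : C) : Cmod a < 1 -> Cmod b <= 1 ->
  Cmod (Cconj a * b) < 1.
Proof.
intros Ha Hb. rewrite Cmod_mult, Cmod_conj.
assert (A := Cmod_ge_0 a). assert (B := Cmod_ge_0 b). nra.
Qed.

Definition mobius (b z : C) : C := ((z - b) / (1 - Cconj b * z))%C.

(** The source of every estimate on Moebius maps: it compares the moduli of
    numerator and denominator. *)
Lemma mobius_identity (b z : C) :
  Cmod (1 - Cconj b * z) ^ 2 - Cmod (z - b) ^ 2 = (1 - Cmod b ^ 2) * (1 - Cmod z ^ 2).
Proof. rewrite !Cmod2_alt. destruct b, z; simpl. ring. Qed.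

Lemma mobius_den (b z : C) : Cmod b < 1 -> Cmod z <= 1 -> (1 - Cconj b * z)%C <> 0.
Proof. intros Hb Hz. apply C1_minus_neq_0, Cmod_mult_conj_lt; assumption. Qed.

Lemma mobius_le_1 (b z : C) : Cmod b < 1 -> Cmod z <= 1 -> Cmod (mobius b z) <= 1.
Proof.
intros Hb Hz. assert (Hd := mobius_den b z Hb Hz). unfold mobius.
rewrite Cmod_div by exact Hd. assert (P := Cmod_pos_lt _ Hd).
apply Rmult_le_reg_r with (Cmod (1 - Cconj b * z)); [exact P|].
unfold Rdiv. rewrite Rmult_assoc, Rinv_l, Rmult_1_r, Rmult_1_l by lra.
apply Cmod_le_sqr. assert (I := mobius_identity b z).
assert (A := Cmod_ge_0 b). assert (B := Cmod_ge_0 z).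
assert (0 <= (1 - Cmod b ^ 2) * (1 - Cmod z ^ 2)) by (apply Rmult_le_pos; nra). lra.
Qed.

Lemma mobius_lt_1 (b z : C) : Cmod b < 1 -> Cmod z < 1 -> Cmod (mobius b z) < 1.
Proof.
intros Hb Hz. assert (Hd := mobius_den b z Hb (Rlt_le _ _ Hz)). unfold mobius.
rewrite Cmod_div by exact Hd. assert (P := Cmod_pos_lt _ Hd).
apply Rmult_lt_reg_r with (Cmod (1 - Cconj b * z)); [exact P|].
unfold Rdiv. rewrite Rmult_assoc, Rinv_l, Rmult_1_r, Rmult_1_l by lra.
apply Cmod_lt_sqr. assert (I := mobius_identity b z).
assert (A := Cmod_ge_0 b). assert (B := Cmod_ge_0 z).
assert (0 < (1 - Cmod b ^ 2) * (1 - Cmod z ^ 2)) by (apply Rmult_lt_0_compat; nra). lra.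
Qed.

Lemma mobius_near_boundary (b : C) (t : R) : Cmod b < 1 -> t < 1 ->
  exists rho, rho < 1 /\ forall z, rho < Cmod z < 1 -> t < Cmod (mobius b z).
Proof.
intros Hb Ht.
destruct (Rle_lt_dec t 0) as [Ht0|Ht0].
{ exists (Cmod b). split; [exact Hb|]. intros z Hz.
  eapply Rle_lt_trans; [exact Ht0|]. apply Cmod_gt_0. unfold mobius.
  assert (Hd := mobius_den b z Hb (Rlt_le _ _ (proj2 Hz))).
  intros E. assert (E2 : (z - b)%C = 0).
  { replace (z - b)%C with ((z - b) / (1 - Cconj b * z) * (1 - Cconj b * z))%C
      by (field; exact Hd). rewrite E. ring. }
  apply (proj1 (Cminus_0_iff _ _)) in E2. subst z. lra. }
assert (B := Cmod_ge_0 b).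
set (e := (1 - t ^ 2) * (1 - Cmod b) ^ 2 / 2).
assert (He : 0 < e) by (unfold e; assert (0 < (1 - t ^ 2) * (1 - Cmod b) ^ 2);
  [apply Rmult_lt_0_compat; nra|lra]).
exists (Rmax 0 (1 - e)). split; [apply Rmax_lub_lt; lra|]. intros z [Hz1 Hz].
assert (Hz0 : 1 - e < Cmod z) by (eapply Rle_lt_trans; [apply Rmax_r|exact Hz1]).
assert (Hd := mobius_den b z Hb (Rlt_le _ _ Hz)). unfold mobius.
rewrite Cmod_div by exact Hd. assert (P := Cmod_pos_lt _ Hd).
apply Rmult_lt_reg_r with (Cmod (1 - Cconj b * z)); [exact P|].
unfold Rdiv. rewrite Rmult_assoc, Rinv_l, Rmult_1_r by lra.
assert (I := mobius_identity b z).
assert (Hden : 1 - Cmod b <= Cmod (1 - Cconj b * z)).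
{ assert (T := Cmod_triangle_rev 1 (Cconj b * z)).
  rewrite Cmod_1, Cmod_mult, Cmod_conj in T.
  assert (Z := Cmod_ge_0 z). nra. }
assert (L : (t * Cmod (1 - Cconj b * z)) ^ 2 < Cmod (z - b) ^ 2).
{ assert (D : (1 - Cmod b) ^ 2 <= Cmod (1 - Cconj b * z) ^ 2) by (apply pow_incr; lra).
  assert (K : (1 - Cmod b ^ 2) * (1 - Cmod z ^ 2) < 2 * e).
  { assert (Z := Cmod_ge_0 z). assert (0 < 1 - Cmod z ^ 2 < 2 * e) by nra.
    assert (0 <= 1 - Cmod b ^ 2 <= 1) by nra. nra. }
  assert (2 * e <= (1 - t ^ 2) * Cmod (1 - Cconj b * z) ^ 2).
  { unfold e. assert (0 <= 1 - t ^ 2) by nra. nra. }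
  nra. }
assert (Q := Cmod_ge_0 (z - b)). nra.
Qed.

Lemma Cdiff_mobius (b z : C) : Cmod b < 1 -> Cmod z <= 1 -> Cdiff (mobius b) z.
Proof.
intros Hb Hz. unfold mobius.
apply (Cdiff_div (fun z => z - b)%C (fun z => 1 - Cconj b * z)%C).
- apply (Cdiff_minus (fun z => z) (fun _ => b)); [apply Cdiff_id|apply Cdiff_const].
- apply (Cdiff_minus (fun _ => RtoC 1) (fun z => Cconj b * z)%C); [apply Cdiff_const|].
  apply (Cdiff_mult (fun _ => Cconj b) (fun z => z)); [apply Cdiff_const|apply Cdiff_id].
- apply mobius_den; assumption.
Qed.

(** The hypothesis only concerns a neighbourhood of the unit circle, and is
    therefore preserved, up to the value of [rho], by the automorphism that sends
    the origin to [a]. *)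
Lemma max_principle_hol (f : C -> C) (rho M : R) : holomorphic_on_disk f ->
  rho < 1 -> (forall z, rho < Cmod z < 1 -> Cmod (f z) <= M) ->
  forall a, Cmod a < 1 -> Cmod (f a) <= M.
Proof.
intros Hf Hrho HM a Ha.
assert (Ha' : Cmod (- a) < 1) by (rewrite Cmod_opp; exact Ha).
destruct (mobius_near_boundary (- a) rho Ha' Hrho) as (r0 & Hr0 & Hnear).
set (r := (1 + Rmax 0 r0) / 2).
assert (Hr : 0 < r < 1 /\ r0 < r).
{ assert (0 <= Rmax 0 r0) by apply Rmax_l. assert (r0 <= Rmax 0 r0) by apply Rmax_r.
  assert (Rmax 0 r0 < 1) by (apply Rmax_lub_lt; lra). unfold r. lra. }
replace a with (mobius (- a) 0).
2:{ unfold mobius. replace (1 - Cconj (- a) * 0)%C with (RtoC 1) by ring. field. }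
apply (Cmod_center_le (fun z => f (mobius (- a) z)) r).
- intros z Hz. apply (Cdiff_comp f (mobius (- a))).
  + apply Hf, mobius_lt_1; assumption.
  + apply Cdiff_mobius; [exact Ha'|apply Rlt_le, Hz].
- apply Hr.
- intros z Hz. apply HM. split.
  + apply Hnear. lra.
  + apply mobius_lt_1; [exact Ha'|lra].
Qed.

(** The exceptional points are those where a quotient has been extended by
    continuity. *)
Definition holomorphic_off (E : list C) (f : C -> C) : Prop :=
  (forall z, Cmod z < 1 -> Ccont f z) /\
  (forall z, Cmod z < 1 -> ~ In z E -> Cdiff f z).

(** Constants independent of [n] disappear on taking [n]-th roots. *)
Lemma le_of_pow_le_pow (x y c K : R) : 0 < c -> 0 < y -> 0 <= K ->
  (forall n, x ^ n * c <= K * y ^ n) -> x <= y.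
Proof.
intros Hc Hy HK H. apply Rnot_lt_le. intros Hlt.
destruct (Pow_x_infinity (x / y)) with (K / c + 1) as [N HN].
{ assert (1 < x / y). { apply Rmult_lt_reg_r with y; [exact Hy|].
    unfold Rdiv. rewrite Rmult_assoc, Rinv_l by lra. lra. }
  rewrite Rabs_pos_eq; lra. }
specialize (HN N (Nat.le_refl N)). specialize (H N).
assert (P : 0 < y ^ N) by (apply pow_lt, Hy).
rewrite Rabs_pos_eq in HN.
2:{ apply pow_le. apply Rlt_le, Rdiv_lt_0_compat; lra. }
unfold Rdiv in HN at 1. rewrite Rpow_mult_distr, pow_inv in HN.
assert (HN2 : (K / c + 1) * y ^ N <= x ^ N).
{ apply Rge_le in HN. apply Rmult_le_compat_r with (r := y ^ N) in HN; [|lra].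
  rewrite (Rmult_assoc (x ^ N)), Rinv_l, Rmult_1_r in HN by lra. exact HN. }
assert (HN3 : (K + c) * y ^ N <= x ^ N * c).
{ replace (K + c) with ((K / c + 1) * c) by (field; lra). nra. }
nra.
Qed.

Lemma Ccont_pow f n z : Ccont f z -> Ccont (fun w => f w ^ n)%C z.
Proof.
intros Hf. induction n as [|n IH]; simpl; [apply Ccont_const|].
apply (Ccont_mult f (fun w => f w ^ n)%C); assumption.
Qed.

Lemma Ccont_bound f (a : C) (M del : R) : Ccont f a -> 0 < del ->
  (forall z, z <> a -> Cmod (z - a) < del -> Cmod (f z) <= M) -> Cmod (f a) <= M.
Proof.
intros Hf Hdel HM. apply Rnot_lt_le. intros Hlt.
destruct (proj1 (Ccont_eps f a) Hf (Cmod (f a) - M)) as (d & Hd & Hw); [lra|].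
set (h := Rmin d del / 2).
assert (Hh : 0 < h /\ h < d /\ h < del).
{ assert (0 < Rmin d del) by (apply Rmin_pos; assumption).
  assert (Rmin d del <= d) by apply Rmin_l. assert (Rmin d del <= del) by apply Rmin_r.
  unfold h. lra. }
assert (E : Cmod (a + h - a) = h).
{ replace (a + h - a)%C with (RtoC h) by ring. rewrite Cmod_R. apply Rabs_pos_eq. lra. }
specialize (Hw (a + h)%C). rewrite E in Hw. specialize (Hw (proj1 (proj2 Hh))).
assert (Hz : Cmod (f (a + h)%C) <= M).
{ apply HM; [|rewrite E; apply Hh]. intros F. rewrite F in E.
  rewrite (proj2 (Cminus_0_iff a a) eq_refl), Cmod_0 in E. lra. }
rewrite Cmod_minus_sym in Hw. assert (T := Cmod_triangle_rev (f a) (f (a + h)%C)). lra.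
Qed.

(** One exceptional point [e] is removed at a time: [f^n * (z - e)] is
    differentiable at [e], and its maximum principle for all [n] yields the one of
    [f] away from [e], hence at [e] by continuity. *)
Lemma max_principle (E : list C) : forall (f : C -> C) (rho M : R), holomorphic_off E f ->
  rho < 1 -> 0 < M -> (forall z, rho < Cmod z < 1 -> Cmod (f z) <= M) ->
  forall a, Cmod a < 1 -> Cmod (f a) <= M.
Proof.
induction E as [|e E IH]; intros f rho M Hf Hrho HMpos HM a Ha.
{ apply (max_principle_hol f rho M); try assumption.
  intros z Hz. apply Hf; [exact Hz|intros []]. }
assert (Hne : forall a, Cmod a < 1 -> a <> e -> Cmod (f a) <= M).
{ clear a Ha. intros a Ha Hae.
  assert (Hc : 0 < Cmod (a - e)).
  { apply Cmod_pos_lt. intros F. apply Hae, Cminus_0_iff, F. }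
  apply (le_of_pow_le_pow _ _ (Cmod (a - e)) (1 + Cmod e)); try assumption.
  { assert (T := Cmod_ge_0 e). lra. }
  intros n. rewrite <- Cmod_pow, <- Cmod_mult.
  apply (IH (fun z => f z ^ n * (z - e))%C rho); try assumption.
  - assert (Hl : forall z, Cdiff (fun z => z - e)%C z).
    { intros z. apply (Cdiff_minus (fun z => z) (fun _ => e)); [apply Cdiff_id|apply Cdiff_const]. }
    split.
    + intros z Hz. apply (Ccont_mult (fun z => f z ^ n)%C (fun z => z - e)%C).
      * apply Ccont_pow, Hf, Hz.
      * apply Cdiff_cont, Hl.
    + intros z Hz Hin. destruct (excluded_middle_informative (z = e)) as [->|Hze].
      * apply (Cdiff_of_slope _ (fun z => f z ^ n)%C); [apply Ccont_pow, Hf, Hz|].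
        intros w. ring.
      * apply (Cdiff_mult (fun z => f z ^ n)%C (fun z => z - e)%C); [|apply Hl].
        apply Cdiff_pow, Hf; [exact Hz|]. intros [F|F]; [apply Hze; symmetry; exact F|].
        contradiction.
  - apply Rmult_lt_0_compat; [assert (T := Cmod_ge_0 e); lra|apply pow_lt, HMpos].
  - intros z Hz. rewrite Cmod_mult, Cmod_pow, Rmult_comm.
    apply Rmult_le_compat; try apply Cmod_ge_0.
    + apply pow_le, Cmod_ge_0.
    + assert (T := Cmod_triangle_minus z e). lra.
    + apply pow_incr. split; [apply Cmod_ge_0|apply HM, Hz]. }
destruct (excluded_middle_informative (a = e)) as [->|Hae]; [|apply Hne; assumption].
apply (Ccont_bound f e M (1 - Cmod e)); [apply Hf, Ha|lra|].
intros z Hz Hd. apply Hne; [|exact Hz].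
assert (T := Cmod_triangle_rev z e). lra.
Qed.

(** * Schwarz-Pick theory with exceptional points *)

Definition schur_off (E : list C) (f : C -> C) : Prop :=
  holomorphic_off E f /\ forall z, Cmod z < 1 -> Cmod (f z) <= 1.

Lemma Cminus_neq_0 (a b : C) : a <> b -> (a - b)%C <> 0.
Proof. intros H F. apply H, Cminus_0_iff, F. Qed.

(** Schwarz's lemma.  The quotient of [f] by [mobius b] is bounded near the unit
    circle by any constant larger than 1, since [mobius b] has modulus close to 1
    there; the maximum principle carries the bound inside. *)
Lemma schwarz_division E f b : schur_off E f -> Cmod b < 1 -> Cdiff f b -> f b = 0 ->
  exists g, schur_off (b :: E) g /\
    forall z, Cmod z < 1 -> (f z = mobius b z * g z)%C.
Proof.
intros [[Hc Hd] H1] Hb Hfb Hf0.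
destruct (Cdiff_slope f b Hfb) as (q & Hqc & Hq & Hqb).
assert (Hlin : forall z, Cdiff (fun z => 1 - Cconj b * z)%C z).
{ intros z. apply (Cdiff_minus (fun _ => RtoC 1) (fun z => Cconj b * z)%C); [apply Cdiff_const|].
  apply (Cdiff_mult (fun _ => Cconj b) (fun z => z)); [apply Cdiff_const|apply Cdiff_id]. }
assert (Hlin2 : forall z, Cdiff (fun z => z - b)%C z).
{ intros z. apply (Cdiff_minus (fun z => z) (fun _ => b)); [apply Cdiff_id|apply Cdiff_const]. }
assert (Hloc : forall z, z <> b -> 0 < Cmod (z - b) /\
  forall w, Cmod (w - z) < Cmod (z - b) -> (f w / (w - b))%C = q w).
{ intros z Hz. split; [apply Cmod_pos_lt, Cminus_neq_0, Hz|].
  intros w Hw. rewrite Hqb, Hf0; [unfold Cdiv; ring|].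
  intros ->. rewrite (Cmod_minus_sym b z) in Hw. lra. }
assert (Hg : holomorphic_off (b :: E) (fun z => q z * (1 - Cconj b * z))%C).
{ split.
  - intros z Hz. apply (Ccont_mult q); [|apply Cdiff_cont, Hlin].
    destruct (excluded_middle_informative (z = b)) as [->|Hzb]; [exact Hqc|].
    destruct (Hloc z Hzb) as [P L].
    apply (Ccont_local (fun w => f w / (w - b))%C q z _ P L).
    apply (Ccont_div f (fun w => w - b)%C); [apply Hc, Hz|apply Cdiff_cont, Hlin2|].
    apply Cminus_neq_0, Hzb.
  - intros z Hz Hin. apply (Cdiff_mult q); [|apply Hlin].
    assert (Hzb : z <> b) by (intros ->; apply Hin; left; reflexivity).
    destruct (Hloc z Hzb) as [P L].
    apply (Cdiff_local (fun w => f w / (w - b))%C q z _ P L).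
    apply (Cdiff_div f (fun w => w - b)%C); [apply Hd; [exact Hz|]|apply Hlin2|].
    + intros F. apply Hin. right. exact F.
    + apply Cminus_neq_0, Hzb. }
assert (Hfg : forall z, Cmod z < 1 -> (f z = mobius b z * (q z * (1 - Cconj b * z)))%C).
{ intros z Hz. replace (f z) with (f z - f b)%C by (rewrite Hf0; ring).
  rewrite Hq. unfold mobius. field. apply mobius_den; [exact Hb|lra]. }
exists (fun z => q z * (1 - Cconj b * z))%C. split; [split; [exact Hg|]|exact Hfg].
intros a Ha.
set (g := fun z => (q z * (1 - Cconj b * z))%C) in *. change (Cmod (g a) <= 1).
apply Rnot_lt_le. intros Hlt.
(* An intermediate bound, larger than 1 but exceeded at [a]. *)
set (M := (1 + Cmod (g a)) / 2).
assert (HM : 1 < M < Cmod (g a)) by (unfold M; lra).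
destruct (mobius_near_boundary b (/ M) Hb) as (rho & Hrho & Hn).
{ rewrite <- Rinv_1. apply Rinv_lt_contravar; lra. }
apply (Rlt_not_le _ _ (proj2 HM)).
apply (max_principle (b :: E) g rho); try assumption; [lra|].
intros z Hz. specialize (Hn z Hz). specialize (H1 z (proj2 Hz)).
rewrite (Hfg z (proj2 Hz)) in H1. fold (g z) in H1. rewrite Cmod_mult in H1.
assert (G := Cmod_ge_0 (g z)).
apply Rmult_le_reg_l with (/ M); [apply Rinv_0_lt_compat; lra|].
rewrite Rinv_l by lra. nra.
Qed.

(** Schwarz's lemma for [mobius (s b) o s], with the denominator cleared. *)
Lemma schwarz_pick_factor E s b : schur_off E s -> Cmod b < 1 -> Cdiff s b ->
  Cmod (s b) < 1 ->
  exists h, schur_off (b :: E) h /\ forall z, Cmod z < 1 ->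
    (s z - s b = mobius b z * h z * (1 - Cconj (s b) * s z))%C.
Proof.
intros [[Hc Hd] H1] Hb Hsb Hlt.
destruct (schwarz_division E (fun z => mobius (s b) (s z)) b) as (h & Hh & Hf).
- split; [split|].
  + intros z Hz. apply (Ccont_comp (mobius (s b)) s); [apply Hc, Hz|].
    apply Cdiff_cont, Cdiff_mobius; [exact Hlt|apply H1, Hz].
  + intros z Hz Hin. apply (Cdiff_comp (mobius (s b)) s); [|apply Hd; assumption].
    apply Cdiff_mobius; [exact Hlt|apply H1, Hz].
  + intros z Hz. apply mobius_le_1; [exact Hlt|apply H1, Hz].
- exact Hb.
- apply (Cdiff_comp (mobius (s b)) s); [|exact Hsb].
  apply Cdiff_mobius; [exact Hlt|lra].
- unfold mobius, Cdiv. ring.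
- exists h. split; [exact Hh|]. intros z Hz. rewrite <- (Hf z Hz).
  unfold mobius. field. apply mobius_den; [exact Hlt|apply H1, Hz].
Qed.

Lemma schwarz_pick E s b z : schur_off E s -> Cmod b < 1 -> Cdiff s b ->
  Cmod (s b) < 1 -> Cmod z < 1 ->
  Cmod (s z - s b) <= Cmod (mobius b z) * Cmod (1 - Cconj (s b) * s z).
Proof.
intros Hs Hb Hsb Hlt Hz.
destruct (schwarz_pick_factor E s b Hs Hb Hsb Hlt) as (h & [_ Hh] & Hf).
rewrite (Hf z Hz), !Cmod_mult. specialize (Hh z Hz).
apply Rmult_le_compat_r; [apply Cmod_ge_0|].
assert (A := Cmod_ge_0 (mobius b z)). nra.
Qed.

(** For unimodular [a] both factors of the Schwarz-Pick inequality measure the same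
    distance, which makes that inequality rigid. *)
Lemma Cmod_1_minus_conj (a w : C) : Cmod a = 1 -> Cmod (1 - Cconj a * w) = Cmod (w - a).
Proof.
intros Ha.
assert (H : (a * Cconj a)%C = 1) by (rewrite <- Cmod_sqr_conj, Ha; f_equal; ring).
replace (w - a)%C with (- (a * (1 - Cconj a * w)))%C.
2:{ transitivity (a * Cconj a * w - a)%C; [ring|]. rewrite H. ring. }
rewrite Cmod_opp, Cmod_mult, Ha. ring.
Qed.

(** The Schwarz-Pick inequality for [lam * s] tends, as [lam] goes to 1, to
    [D <= t D] with [t < 1] and [D = |s z - s b|]. *)
Lemma strong_max_diff E s b z : schur_off E s -> Cmod b < 1 -> Cdiff s b ->
  Cmod (s b) = 1 -> Cmod z < 1 -> s z = s b.
Proof.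
intros [[Hc Hd] H1] Hb Hsb Hmod Hz.
set (t := Cmod (mobius b z)). set (D := Cmod (s z - s b)).
assert (Ht : 0 <= t < 1) by (split; [apply Cmod_ge_0|apply mobius_lt_1; assumption]).
assert (HD : 0 <= D) by apply Cmod_ge_0.
assert (Hlam : forall lam, 0 < lam < 1 -> lam * D <= t * (D + (1 - lam ^ 2))).
{ intros lam Hl.
  assert (Hsc : forall w, Cmod (lam * s w) = lam * Cmod (s w)).
  { intros w. rewrite Cmod_mult, Cmod_R, Rabs_pos_eq; lra. }
  assert (P := schwarz_pick E (fun w => lam * s w)%C b z). cbv beta in P.
  replace (lam * s z - lam * s b)%C with (lam * (s z - s b))%C in P by ring.
  rewrite (Cmod_mult lam (s z - s b)), Cmod_R, Rabs_pos_eq in P by lra. fold D t in P.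
  eapply Rle_trans; [apply P; try assumption|].
  - split; [split|].
    + intros w Hw. apply (Ccont_mult (fun _ => RtoC lam) s); [apply Ccont_const|apply Hc, Hw].
    + intros w Hw Hin. apply (Cdiff_mult (fun _ => RtoC lam) s); [apply Cdiff_const|apply Hd; assumption].
    + intros w Hw. rewrite Hsc. specialize (H1 w Hw). assert (Q := Cmod_ge_0 (s w)). nra.
  - apply (Cdiff_mult (fun _ => RtoC lam) s); [apply Cdiff_const|exact Hsb].
  - rewrite Hsc, Hmod. lra.
  - apply Rmult_le_compat_l; [apply Ht|]. unfold D.
    rewrite <- (Cmod_1_minus_conj (s b)) by exact Hmod.
    replace (1 - Cconj (lam * s b) * (lam * s z))%C
      with ((1 - Cconj (s b) * s z) + RtoC (1 - lam ^ 2) * (Cconj (s b) * s z))%C.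
    2:{ rewrite Cmult_conj. replace (Cconj lam) with (RtoC lam).
        2:{ unfold Cconj, RtoC; simpl; f_equal; ring. }
        rewrite RtoC_minus, RtoC_pow. ring. }
    eapply Rle_trans; [apply Cmod_triangle|]. apply Rplus_le_compat_l.
    rewrite !Cmod_mult, Cmod_R, Rabs_pos_eq, Cmod_conj, Hmod by nra.
    specialize (H1 z Hz). assert (0 <= 1 - lam ^ 2) by nra. nra. }
apply (proj1 (Cminus_0_iff _ _)). apply Cmod_eq_0. fold D.
destruct (Rle_lt_or_eq_dec 0 D HD) as [Hpos|<-]; [|reflexivity]. exfalso.
(* For [lam = 1 - e] the inequality reads [(1 - t) D <= e (D + 2 t - t e)],
   which fails for small [e]. *)
set (e := (1 - t) * D / (2 * (D + 2))).
assert (He : e * (2 * (D + 2)) = (1 - t) * D) by (unfold e; field; lra).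
assert (0 < (1 - t) * D) by (apply Rmult_lt_0_compat; lra).
assert (He0 : 0 < e) by (unfold e; apply Rdiv_lt_0_compat; lra).
assert (He1 : e < 1) by nra.
specialize (Hlam (1 - e)). assert (Hl : 0 < 1 - e < 1) by lra. specialize (Hlam Hl).
assert (t * e <= e) by nra. nra.
Qed.

Lemma finite_avoid (E : list C) (b : C) : exists del, 0 < del /\
  forall z, z <> b -> Cmod (z - b) < del -> ~ In z E.
Proof.
induction E as [|e E (d & Hd & H)]; [exists 1; split; [lra|intros z _ _ []]|].
destruct (excluded_middle_informative (e = b)) as [->|He].
- exists d. split; [exact Hd|]. intros z Hz Hlt [F|F]; [apply Hz; symmetry; exact F|].
  exact (H z Hz Hlt F).
- exists (Rmin d (Cmod (e - b))). split.
  { apply Rmin_pos; [exact Hd|]. apply Cmod_pos_lt, Cminus_neq_0, He. }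
  intros z Hz Hlt [F|F].
  + subst z. assert (Rmin d (Cmod (e - b)) <= Cmod (e - b)) by apply Rmin_r. lra.
  + apply (H z Hz); [|exact F]. eapply Rlt_le_trans; [exact Hlt|apply Rmin_l].
Qed.

Lemma Cmod_mobius_sym (a b : C) : Cmod a < 1 -> Cmod b < 1 ->
  Cmod (mobius a b) = Cmod (mobius b a).
Proof.
intros Ha Hb. unfold mobius.
rewrite !Cmod_div by (apply mobius_den; lra). f_equal; [apply Cmod_minus_sym|].
rewrite <- Cmod_conj. f_equal.
rewrite Cminus_conj, Cmult_conj, Cconj_conj. 
replace (Cconj 1) with (RtoC 1) by (unfold Cconj, RtoC; simpl; f_equal; ring). ring.
Qed.

(** At an exceptional point [b] the inequality is used at nearby regular points
    [b'], with an error controlled by the continuity of [s] and of the Moebius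
    factor. *)
Theorem strong_max E s b z : schur_off E s -> Cmod b < 1 -> Cmod (s b) = 1 ->
  Cmod z < 1 -> s z = s b.
Proof.
intros Hs Hb Hmod Hz.
set (t := Cmod (mobius z b)). set (D := Cmod (s z - s b)).
assert (Ht : t < 1) by (apply mobius_lt_1; assumption).
assert (HD : 0 <= D) by apply Cmod_ge_0.
apply (proj1 (Cminus_0_iff _ _)). apply Cmod_eq_0. fold D.
destruct (Rle_lt_or_eq_dec 0 D HD) as [Hpos|<-]; [|reflexivity]. exfalso.
assert (Ht0 : 0 <= t) by apply Cmod_ge_0.
set (e := (1 - t) * D / 8).
assert (He : 0 < e) by (unfold e; apply Rdiv_lt_0_compat; [apply Rmult_lt_0_compat; lra|lra]).
destruct (finite_avoid E b) as (d0 & Hd0 & Hav).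
destruct (proj1 (Ccont_eps s b) (proj1 (proj1 Hs) b Hb) e He) as (d1 & Hd1 & Hw1).
destruct (proj1 (Ccont_eps (mobius z) b)
  (Cdiff_cont _ _ (Cdiff_mobius z b Hz (Rlt_le _ _ Hb))) ((1 - t) / 2)) as (d2 & Hd2 & Hw2); [lra|].
set (k := Rmin (Rmin d0 d1) (Rmin d2 (1 - Cmod b)) / 2).
assert (Hk : 0 < k /\ k < d0 /\ k < d1 /\ k < d2 /\ k < 1 - Cmod b).
{ assert (0 < Rmin (Rmin d0 d1) (Rmin d2 (1 - Cmod b))) by (repeat apply Rmin_pos; lra).
  unfold k in *. revert H. unfold Rmin. repeat destruct Rle_dec; intros; lra. }
destruct Hk as (K0 & K1 & K2 & K3 & K4).
set (b' := (b + k)%C).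
assert (Eb : Cmod (b' - b) = k).
{ unfold b'. replace (b + k - b)%C with (RtoC k) by ring. rewrite Cmod_R. apply Rabs_pos_eq. lra. }
assert (Hne : b' <> b).
{ intros F. rewrite F, (proj2 (Cminus_0_iff b b) eq_refl), Cmod_0 in Eb. lra. }
assert (Hb' : Cmod b' < 1) by (assert (T := Cmod_triangle_rev b' b); lra).
assert (Hdiff : Cdiff s b').
{ apply (proj2 (proj1 Hs)); [exact Hb'|]. apply Hav; [exact Hne|lra]. }
specialize (Hw1 b'). rewrite Eb in Hw1. specialize (Hw1 K2).
specialize (Hw2 b'). rewrite Eb in Hw2. specialize (Hw2 K3).
assert (H1 := proj2 Hs b' Hb').
destruct (Rle_lt_or_eq_dec _ _ H1) as [Hlt|Heq].
- assert (P := schwarz_pick E s b' z Hs Hb' Hdiff Hlt Hz).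
  rewrite (Cmod_mobius_sym b' z Hb' Hz) in P.
  assert (T1 : Cmod (mobius z b') <= (1 + t) / 2).
  { assert (T := Cmod_triangle_rev (mobius z b') (mobius z b)). fold t in T. lra. }
  assert (T2 : D - e <= Cmod (s z - s b')).
  { assert (T := Cmod_triangle (s z - s b') (s b' - s b)).
    replace (s z - s b' + (s b' - s b))%C with (s z - s b)%C in T by ring.
    fold D in T. lra. }
  assert (T3 : Cmod (1 - Cconj (s b') * s z) <= D + e).
  { unfold D. rewrite <- (Cmod_1_minus_conj (s b)) by exact Hmod.
    replace (1 - Cconj (s b') * s z)%C
      with ((1 - Cconj (s b) * s z) - Cconj (s b' - s b) * s z)%C
      by (rewrite Cminus_conj; ring).
    eapply Rle_trans; [apply Cmod_triangle_minus|]. apply Rplus_le_compat_l.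
    rewrite Cmod_mult, Cmod_conj.
    assert (A := proj2 Hs z Hz). assert (B := Cmod_ge_0 (s b' - s b)).
    assert (B' := Cmod_ge_0 (s z)). nra. }
  assert (T4 : Cmod (mobius z b') * Cmod (1 - Cconj (s b') * s z) <= (1 + t) / 2 * (D + e)).
  { apply Rmult_le_compat; try apply Cmod_ge_0; assumption. }
  assert (D - e <= (1 + t) / 2 * (D + e)) by lra.
  assert (8 * e = (1 - t) * D) by (unfold e; field). nra.
- assert (Ez := strong_max_diff E s b' z Hs Hb' Hdiff Heq Hz).
  assert (Eb2 := strong_max_diff E s b' b Hs Hb' Hdiff Heq Hb).
  unfold D in Hpos. rewrite Ez, Eb2, (proj2 (Cminus_0_iff _ _) eq_refl), Cmod_0 in Hpos. lra.
Qed.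

(** * Parametrization of the maps fixing p *)

Lemma Cconj_R (r : R) : Cconj r = RtoC r.
Proof. unfold Cconj, RtoC; simpl; f_equal; ring. Qed.

(** When [|s| = 1] the map [mobius (- s)] degenerates to the constant [s] on the
    disk; admitting this case lets one formula cover all Schur parameters. *)
Lemma mobius_opp_closed (s w : C) : Cmod s <= 1 -> Cmod w < 1 -> 
  (1 + Cconj s * w)%C <> 0 /\ mobius (- s) w = ((s + w) / (1 + Cconj s * w))%C /\
  Cmod (mobius (- s) w) <= 1.
Proof.
intros Hs Hw.
assert (Hd : (1 + Cconj s * w)%C <> 0) by (apply C1_plus_neq_0, Cmod_conj_mult_lt; assumption).
assert (E : mobius (- s) w = ((s + w) / (1 + Cconj s * w))%C).
{ unfold mobius. rewrite Copp_conj. apply (f_equal2 Cdiv); ring. }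
split; [exact Hd|split; [exact E|]]. rewrite E.
rewrite Cmod_div by exact Hd. assert (P := Cmod_pos_lt _ Hd).
apply Rmult_le_reg_r with (Cmod (1 + Cconj s * w)); [exact P|].
unfold Rdiv. rewrite Rmult_assoc, Rinv_l, Rmult_1_r, Rmult_1_l by lra.
apply Cmod_le_sqr. assert (I := mobius_identity (- s) w).
replace (1 - Cconj (- s) * w)%C with (1 + Cconj s * w)%C in I by (rewrite Copp_conj; ring).
replace (w - - s)%C with (s + w)%C in I by ring. rewrite Cmod_opp in I.
assert (A := Cmod_ge_0 s). assert (B := Cmod_ge_0 w).
assert (0 <= (1 - Cmod s ^ 2) * (1 - Cmod w ^ 2)) by (apply Rmult_le_pos; nra). lra.
Qed.

Lemma mobius_cancel (b w : C) : Cmod b < 1 -> Cmod w <= 1 -> mobius b (mobius (- b) w) = w.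
Proof.
intros Hb Hw.
assert (Hb' : Cmod (- b) < 1) by (rewrite Cmod_opp; exact Hb).
assert (Hd := mobius_den (- b) w Hb' Hw). rewrite Copp_conj in Hd.
assert (Hbb : (1 - Cconj b * b)%C <> 0) by (apply mobius_den; lra).
unfold mobius. rewrite Copp_conj.
assert (Hd2 : (1 - - Cconj b * w - Cconj b * (w - - b))%C <> 0).
{ replace (1 - - Cconj b * w - Cconj b * (w - - b))%C with (1 - Cconj b * b)%C by ring. exact Hbb. }
field. split; assumption.
Qed.

Lemma mobius_cancel_opp (b w : C) : Cmod b < 1 -> Cmod w <= 1 -> mobius (- b) (mobius b w) = w.
Proof.
intros Hb Hw. assert (H := mobius_cancel (- b) w). rewrite Cmod_opp in H.
replace (- - b)%C with b in H by ring. apply H; assumption.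
Qed.

(** The solution of
    [mobius p (Phi p s h z) = mobius p z * ((s + h z) / (1 + conj s * h z))],
    the second factor being the general self-map of the disk with value [s] at 0
    when [h] is allowed to depend on [z]. *)
Definition Phi (p : R) (s h z : C) : C :=
  mobius (- p) (mobius p z * mobius (- s) (h * z))%C.

Lemma Cmod_real_lt_1 (p : R) : 0 < p < 1 -> Cmod p < 1.
Proof. intros H. rewrite Cmod_R, Rabs_pos_eq; lra. Qed.

Lemma Cmod_mult_lt_1 (a b : C) : Cmod a <= 1 -> Cmod b < 1 -> Cmod (a * b) < 1.
Proof.
intros Ha Hb. rewrite Cmod_mult. assert (A := Cmod_ge_0 a). assert (B := Cmod_ge_0 b). nra.
Qed.

Lemma Phi_inner_lt_1 (p : R) (s h z : C) : 0 < p < 1 -> Cmod s <= 1 -> Cmod h <= 1 -> Cmod z < 1 ->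
  Cmod (mobius p z * mobius (- s) (h * z)) < 1.
Proof.
intros Hp Hs Hh Hz. rewrite Cmult_comm. apply Cmod_mult_lt_1.
- apply mobius_opp_closed; [exact Hs|apply Cmod_mult_lt_1; assumption].
- apply mobius_lt_1; [apply Cmod_real_lt_1, Hp|exact Hz].
Qed.

Lemma Phi_mobius (p : R) (s h z : C) : 0 < p < 1 -> Cmod s <= 1 -> Cmod h <= 1 -> Cmod z < 1 ->
  mobius p (Phi p s h z) = (mobius p z * mobius (- s) (h * z))%C.
Proof.
intros Hp Hs Hh Hz. apply mobius_cancel; [apply Cmod_real_lt_1, Hp|].
left. apply Phi_inner_lt_1; assumption.
Qed.

Lemma Phi_in_B (p : R) (s h : C) : 0 < p < 1 -> Cmod s <= 1 -> Cmod h <= 1 -> B p (Phi p s h).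
Proof.
intros Hp Hs Hh. assert (Hp1 := Cmod_real_lt_1 p Hp).
assert (Hp2 : Cmod (- p) < 1) by (rewrite Cmod_opp; exact Hp1).
split; [split|].
- intros z Hz. red in Hz.
  apply (Cdiff_comp (mobius (- p)) (fun z => mobius p z * mobius (- s) (h * z))%C).
  { apply Cdiff_mobius; [exact Hp2|]. left. apply Phi_inner_lt_1; assumption. }
  apply (Cdiff_mult (mobius p) (fun z => mobius (- s) (h * z))).
  { apply Cdiff_mobius; [exact Hp1|left; exact Hz]. }
  assert (Hhz : Cdiff (fun z => h * z)%C z).
  { apply (Cdiff_mult (fun _ => h) (fun z => z)); [apply Cdiff_const|apply Cdiff_id]. }
  unfold mobius. apply (Cdiff_div (fun z => h * z - - s)%C (fun z => 1 - Cconj (- s) * (h * z))%C).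
  + apply (Cdiff_minus (fun z => h * z)%C (fun _ => (- s)%C)); [exact Hhz|apply Cdiff_const].
  + apply (Cdiff_minus (fun _ => RtoC 1)); [apply Cdiff_const|].
    apply (Cdiff_mult (fun _ => Cconj (- s)) (fun z => h * z)%C); [apply Cdiff_const|exact Hhz].
  + apply C1_minus_neq_0, Cmod_conj_mult_lt; [rewrite Cmod_opp; exact Hs|].
    apply Cmod_mult_lt_1; assumption.
- intros z Hz. apply mobius_lt_1; [exact Hp2|]. apply Phi_inner_lt_1; assumption.
- unfold Phi. replace (mobius p p) with (RtoC 0) by (unfold mobius, Cdiv; ring).
  unfold mobius, Cdiv. rewrite Cmult_0_l.
  replace (1 - Cconj (- p) * 0)%C with (RtoC 1) by ring. field.
Qed.

(** Two divisions: by [mobius p] because [phi] fixes [p], then by [mobius 0] after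
    normalizing the quotient [g] at the origin.  The second one requires
    [|g 0| < 1]; when [|g 0| = 1] the function [g] is constant and [h = 0]
    serves. *)
Lemma B_parametrization (p : R) (phi : C -> C) : 0 < p < 1 -> B p phi ->
  exists (s : C) (h : C -> C) (E : list C),
    Cmod s <= 1 /\ schur_off E h /\
    forall z, Cmod z < 1 -> phi z = Phi p s (h z) z.
Proof.
intros Hp [[Hd Hm] Hfix]. assert (Hp1 := Cmod_real_lt_1 p Hp).
assert (H0 : Cmod 0 < 1) by (rewrite Cmod_0; lra).
assert (Hkd : forall z, Cmod z < 1 -> Cdiff (fun z => mobius p (phi z)) z).
{ intros z Hz. apply (Cdiff_comp (mobius p) phi); [|apply Hd, Hz].
  apply Cdiff_mobius; [exact Hp1|left; apply Hm, Hz]. }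
destruct (schwarz_division nil (fun z => mobius p (phi z)) p) as (g & Hg & Hgk).
{ split; [split|].
  - intros z Hz. apply Cdiff_cont, Hkd, Hz.
  - intros z Hz _. apply Hkd, Hz.
  - intros z Hz. left. apply mobius_lt_1; [exact Hp1|apply Hm, Hz]. }
{ exact Hp1. } { apply Hkd, Hp1. }
{ rewrite Hfix. unfold mobius, Cdiv. ring. }
assert (Hphi : forall z, Cmod z < 1 -> phi z = mobius (- p) (mobius p z * g z)%C).
{ intros z Hz. rewrite <- (Hgk z Hz). symmetry. apply mobius_cancel_opp; [exact Hp1|left; apply Hm, Hz]. }
assert (Hg0 := proj2 Hg 0 H0).
exists (g 0).
destruct (Rle_lt_or_eq_dec _ _ Hg0) as [Hlt|Heq].
- destruct (schwarz_pick_factor (RtoC p :: nil) g 0 Hg H0) as (h & Hh & Hgh).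
  { apply (proj2 (proj1 Hg)); [exact H0|]. intros [F|[]]. apply RtoC_inj in F. lra. }
  { exact Hlt. }
  exists h, (RtoC 0 :: RtoC p :: nil). split; [exact Hg0|split; [exact Hh|]].
  intros z Hz. rewrite (Hphi z Hz). unfold Phi. do 2 f_equal.
  destruct (mobius_opp_closed (g 0) (h z * z) Hg0) as (Hden & -> & _).
  { apply Cmod_mult_lt_1; [apply Hh, Hz|exact Hz]. }
  assert (E := Hgh z Hz).
  replace (mobius 0 z) with z in E.
  2:{ unfold mobius. replace (Cconj 0) with (RtoC 0) by (symmetry; apply Cconj_R). field. }
  replace (g 0 + h z * z)%C with (g z * (1 + Cconj (g 0) * (h z * z)))%C.
  2:{ replace (g z * (1 + Cconj (g 0) * (h z * z)))%C
        with (g 0 + (g z - g 0) + g z * (Cconj (g 0) * (h z * z)))%C by ring.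
      rewrite E. ring. }
  field. exact Hden.
- exists (fun _ => RtoC 0), nil. split; [exact Hg0|split; [|]].
  + split; [split|].
    * intros z _. apply Ccont_const.
    * intros z _ _. apply Cdiff_const.
    * intros z _. rewrite Cmod_0. lra.
  + intros z Hz. rewrite (Hphi z Hz). unfold Phi. do 2 f_equal.
    rewrite (strong_max _ _ 0 z Hg H0 Heq Hz).
    unfold mobius. rewrite !Cmult_0_l, !Cmult_0_r. field.
Qed.

(** * Second order expansion at the origin *)

Lemma locally_C0_iff (P : C -> Prop) : locally (T := C_UniformSpace) (RtoC 0) P <->
  exists del, 0 < del /\ forall z, Cmod z < del -> P z.
Proof.
split.
- intros [e He]. exists e. split; [apply cond_pos|]. intros z Hz. apply He.
  apply C_NormedModule_mixin_compat1.
  replace (minus z (RtoC 0)) with z; [exact Hz|].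
  unfold minus, plus, opp; simpl. change (z = z - 0)%C. ring.
- intros (del & Hd & H). assert (Hd2 : 0 < del / 2) by lra.
  exists (mkposreal _ Hd2). intros z Hz. apply H.
  eapply Rle_lt_trans; [apply Cmod_le_sum|]. destruct Hz as [H1 H2].
  unfold ball in H1, H2; simpl in H1, H2. unfold AbsRing_ball, abs, minus, plus, opp in H1, H2.
  simpl in H1, H2. rewrite !Ropp_0, !Rplus_0_r in H1, H2. lra.
Qed.

Lemma has_expansion_0_iff phi c0 : has_expansion 0 phi c0 <->
  exists M del, 0 < del /\ forall z, Cmod z < del -> Cmod (phi z - c0) <= M * Cmod z.
Proof.
split.
- intros [M H]. apply locally_C0_iff in H. destruct H as (del & Hd & H).
  exists M, del. split; [exact Hd|]. intros z Hz. specialize (H z Hz). simpl in H.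
  rewrite Rmult_1_r in H. exact H.
- intros (M & del & Hd & H). exists M. apply locally_C0_iff. exists del. split; [exact Hd|].
  intros z Hz. specialize (H z Hz). simpl. rewrite Rmult_1_r. exact H.
Qed.

Lemma has_expansion_1_iff phi c0 c1 : has_expansion 1 phi (c0, c1) <->
  exists M del, 0 < del /\ forall z, Cmod z < del ->
    Cmod (phi z - (c0 + z * c1)) <= M * Cmod z ^ 2.
Proof.
split.
- intros [M H]. apply locally_C0_iff in H. exists M. exact H.
- intros (M & H). exists M. apply locally_C0_iff. exact H.
Qed.

(** The constant coefficient of [Phi p s h] at the origin. *)
Definition coef0 (p : R) (s : C) : C := (p * (1 - s) / (1 - p * p * s))%C.
(** The linear coefficient of [Phi p s h] at the origin; [s * Cconj s] is the
    square of the modulus of [s]. *)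
Definition coef1 (p : R) (s h : C) : C :=
  ((1 - p * p) * ((1 - p * p) * s - p * (1 - s * Cconj s) * h)
   / ((1 - p * p * s) * (1 - p * p * s)))%C.

Lemma coef_den (p : R) (s : C) : 0 < p < 1 -> Cmod s <= 1 -> (1 - p * p * s)%C <> 0.
Proof.
intros Hp Hs. apply C1_minus_neq_0. rewrite !Cmod_mult, Cmod_R, Rabs_pos_eq by lra.
assert (A := Cmod_ge_0 s). assert (p * p < 1) by nra. nra.
Qed.

Ltac ccont := lazymatch goal with
  | |- Ccont (fun _ => ?c) _ => apply (Ccont_const c)
  | |- Ccont (fun w => w) _ => apply Ccont_id
  | |- Ccont (fun w => (@?f w + @?g w)%C) _ => apply (Ccont_plus f g); ccont
  | |- Ccont (fun w => (@?f w - @?g w)%C) _ => apply (Ccont_minus f g); ccont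
  | |- Ccont (fun w => (@?f w * @?g w)%C) _ => apply (Ccont_mult f g); ccont
  | |- Ccont (fun w => (@?f w / @?g w)%C) _ => apply (Ccont_div f g); [ccont|ccont|]
  | |- Ccont _ _ => try assumption
  end.

Lemma Phi_fraction (P A X Y Z : C) : X <> 0 -> Z <> 0 ->
  (X * Z + P * A * Y)%C <> 0 ->
  ((P + A / X * (Y / Z)) / (1 + P * (A / X * (Y / Z))) =
   (A * Y + P * (X * Z)) / (X * Z + P * A * Y))%C.
Proof.
intros HX HZ HD. field. repeat split; assumption.
Qed.

(** Substituting constants in place of the two Moebius factors gives a quotient of
    quadratic polynomials in [z]. *)
Lemma Phi_rational (p : R) (s h z : C) : 0 < p < 1 -> Cmod s <= 1 -> Cmod h <= 1 ->
  Cmod z < 1 ->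
  let X := ((z - p) * (s + h * z))%C in
  let Y := ((1 - p * z) * (1 + Cconj s * (h * z)))%C in
  (Y + p * X)%C <> 0 /\ Phi p s h z = ((X + p * Y) / (Y + p * X))%C.
Proof.
intros Hp Hs Hh Hz X Y.
assert (Hp1 := Cmod_real_lt_1 p Hp).
assert (Hhz : Cmod (h * z) < 1) by (apply Cmod_mult_lt_1; assumption).
destruct (mobius_opp_closed s (h * z) Hs Hhz) as (D1 & E1 & _).
assert (Hin := Phi_inner_lt_1 p s h z Hp Hs Hh Hz).
destruct (mobius_opp_closed p _ (Rlt_le _ _ Hp1) Hin) as (D2 & E2 & _).
assert (D3 := mobius_den p z Hp1 (Rlt_le _ _ Hz)).
unfold Phi. rewrite E2. rewrite E1 in *. unfold mobius in *. rewrite Cconj_R in *.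
assert (HY : (Y + p * X)%C <> 0).
{ intros F. apply D2. transitivity ((Y + p * X) / Y)%C.
  - unfold X, Y. field. split; assumption.
  - rewrite F. unfold Cdiv. ring. }
split; [exact HY|].
assert (HY' : ((1 - p * z) * (1 + Cconj s * (h * z)) + p * (z - p) * (s + h * z))%C <> 0).
{ intros F. apply HY. rewrite <- F. unfold X, Y. ring. }
rewrite Phi_fraction by assumption.
apply (f_equal2 Cdiv); unfold X, Y; ring.
Qed.

(** Comparison of the coefficients of [z] in the identity stating that the
    numerator of [Phi] is [coef0 + coef1 * z + O(z^2)] times its denominator. *)
Lemma coef1_equation (p : R) (s h : C) : 0 < p < 1 -> Cmod s <= 1 ->
  (coef1 p s h * (1 - p * p * s) = s - p * h + p * (Cconj s * h - p)
    - coef0 p s * (Cconj s * h - p + p * (s - p * h)))%C.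
Proof.
intros Hp Hs. assert (Hd := coef_den p s Hp Hs). unfold coef0, coef1. field. exact Hd.
Qed.

(** With [Phi] as a quotient of quadratic polynomials whose coefficients depend on
    [h z], the remainder is [z^2] times a quotient that is continuous at 0.  The
    function [h] is only continuous there, so its value is kept at [z] and not at
    0. *)
Lemma Phi_expansion (p : R) (s : C) (h : C -> C) : 0 < p < 1 -> Cmod s <= 1 ->
  Ccont h 0 -> (forall z, Cmod z < 1 -> Cmod (h z) <= 1) ->
  exists M del, 0 < del /\ forall z, Cmod z < del ->
    Cmod (Phi p s (h z) z - (coef0 p s + z * coef1 p s (h z))) <= M * Cmod z ^ 2.
Proof.
intros Hp Hs Hc Hh.
set (den := fun z : C => ((1 - p * z) * (1 + Cconj s * (h z * z)) + p * (z - p) * (s + h z * z))%C).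
set (c0 := coef0 p s). set (c1 := fun z => coef1 p s (h z)).
set (d1 := fun z : C => (Cconj s * h z - p + p * (s - p * h z))%C).
set (d2 := fun z : C => (p * h z - p * (Cconj s * h z))%C).
set (n2 := fun z : C => (h z - p * p * (Cconj s * h z))%C).
set (rem := fun z : C => ((n2 z - c0 * d2 z - c1 z * d1 z - c1 z * d2 z * z) / den z)%C).
assert (Hd0 := coef_den p s Hp Hs).
assert (Hden0 : den 0 = (1 - p * p * s)%C) by (unfold den; ring).
assert (Hrem : Ccont rem 0).
{ assert (Hcc1 : Ccont c1 0).
  { unfold c1, coef1. apply Ccont_div; [ccont|apply Ccont_const|].
    apply Cmult_neq_0; assumption. }
  unfold rem, n2, d1, d2, den. ccont. change (den 0 <> 0). rewrite Hden0. exact Hd0. }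
destruct (proj1 (Ccont_eps rem 0) Hrem 1 Rlt_0_1) as (del & Hdel & Hw).
exists (Cmod (rem 0) + 1), (Rmin del 1). split; [apply Rmin_pos; lra|].
intros z Hz.
assert (Hz1 : Cmod z < 1) by (eapply Rlt_le_trans; [exact Hz|apply Rmin_r]).
assert (Hz2 : Cmod z < del) by (eapply Rlt_le_trans; [exact Hz|apply Rmin_l]).
specialize (Hw z). replace (z - 0)%C with z in Hw by ring. specialize (Hw Hz2).
destruct (Phi_rational p s (h z) z Hp Hs (Hh z Hz1) Hz1) as [Hden EPhi].
cbv zeta in Hden, EPhi.
assert (Hdz : den z <> 0).
{ intros F. apply Hden. rewrite <- F. unfold den. ring. }
assert (E : (Phi p s (h z) z - (c0 + z * coef1 p s (h z)) = rem z * z * z)%C).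
{ rewrite EPhi. change (coef1 p s (h z)) with (c1 z).
  replace ((1 - p * z) * (1 + Cconj s * (h z * z)) + p * ((z - p) * (s + h z * z)))%C
    with (den z) by (unfold den; ring).
  assert (F0 : (c0 * (1 - p * p * s) = p * (1 - s))%C) by (unfold c0, coef0; field; exact Hd0).
  assert (F1 := coef1_equation p s (h z) Hp Hs). fold c0 in F1.
  change (coef1 p s (h z)) with (c1 z) in F1.
  replace ((z - p) * (s + h z * z) + p * ((1 - p * z) * (1 + Cconj s * (h z * z))))%C
    with ((n2 z - c0 * d2 z - c1 z * d1 z - c1 z * d2 z * z) * z * z
          + (c0 + z * c1 z) * den z)%C.
  - unfold rem. field. exact Hdz.
  - transitivity (n2 z * z * z + c0 * (1 - p * p * s)
      + z * (c1 z * (1 - p * p * s) + c0 * d1 z))%C; [unfold den, d1, d2; ring|].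
    rewrite F0, F1. unfold n2, d1. ring. }
rewrite E, !Cmod_mult. simpl. rewrite Rmult_1_r, <- Rmult_assoc.
assert (T := Cmod_triangle_rev (rem z) (rem 0)).
assert (Z := Cmod_ge_0 z).
apply Rmult_le_compat_r; [exact Z|]. apply Rmult_le_compat_r; [exact Z|]. lra.
Qed.

(** Used to read off coefficients from a comparison of two expansions. *)
Lemma Ccont_zero_bound f : Ccont f 0 -> (exists K del, 0 < del /\
    forall z : C, z <> 0 -> Cmod z < del -> Cmod (f z) <= K * Cmod z) -> f 0 = 0.
Proof.
intros Hf (K & del & Hd & H). apply Cmod_eq_0.
assert (A := Cmod_ge_0 (f 0)). apply Rle_antisym; [|exact A].
apply Rnot_lt_le. intros Hlt.
set (e := Cmod (f 0) / 2). assert (He : 0 < e) by (unfold e; lra).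
assert (Hb : Cmod (f 0) <= e); [|unfold e in Hb; lra].
assert (0 < Rabs K + 1) by (assert (Q := Rabs_pos K); lra).
apply (Ccont_bound f 0 e (Rmin del (e / (Rabs K + 1))) Hf).
- apply Rmin_pos; [exact Hd|]. apply Rdiv_lt_0_compat; lra.
- intros z Hz Hlt2. replace (z - 0)%C with z in Hlt2 by ring.
  assert (L1 : Cmod z < del) by (eapply Rlt_le_trans; [exact Hlt2|apply Rmin_l]).
  assert (L2 : Cmod z < e / (Rabs K + 1)) by (eapply Rlt_le_trans; [exact Hlt2|apply Rmin_r]).
  eapply Rle_trans; [apply H; assumption|].
  assert (Q := Rle_abs K). assert (Z := Cmod_ge_0 z).
  assert (E : (Rabs K + 1) * (e / (Rabs K + 1)) = e) by (field; lra). nra.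
Qed.

Lemma Phi_at_0 (p : R) (s h : C) : 0 < p < 1 -> Cmod s <= 1 -> Phi p s h 0 = coef0 p s.
Proof.
intros Hp Hs. assert (Hd := coef_den p s Hp Hs).
unfold Phi, mobius, coef0. rewrite !Copp_conj, !Cconj_R. field.
replace (1 - 0 - - p * (- p * s))%C with (1 - p * p * s)%C by ring. exact Hd.
Qed.

Lemma expansion_0_value phi c0 : has_expansion 0 phi c0 -> c0 = phi 0.
Proof.
intros H. apply has_expansion_0_iff in H. destruct H as (M & del & Hd & H).
specialize (H 0). rewrite Cmod_0, Rmult_0_r in H. specialize (H Hd).
symmetry. apply (proj1 (Cminus_0_iff _ _)). apply Cmod_eq_0.
apply Rle_antisym; [exact H|apply Cmod_ge_0].
Qed.

Lemma expansion_1_0 phi c0 c1 : has_expansion 1 phi (c0, c1) -> has_expansion 0 phi c0.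
Proof.
intros H. apply has_expansion_1_iff in H. destruct H as (M & del & Hd & H).
apply has_expansion_0_iff. exists (Rabs M + Cmod c1), (Rmin del 1).
split; [apply Rmin_pos; lra|]. intros z Hz.
assert (L1 : Cmod z < del) by (eapply Rlt_le_trans; [exact Hz|apply Rmin_l]).
assert (L2 : Cmod z < 1) by (eapply Rlt_le_trans; [exact Hz|apply Rmin_r]).
specialize (H z L1). replace (phi z - c0)%C with ((phi z - (c0 + z * c1)) + z * c1)%C by ring.
eapply Rle_trans; [apply Cmod_triangle|]. rewrite Cmod_mult.
assert (Z := Cmod_ge_0 z). assert (Q := Rle_abs M). assert (Q' := Rabs_pos M).
assert (M * Cmod z ^ 2 <= Rabs M * Cmod z); [|lra].
apply Rle_trans with (Rabs M * Cmod z ^ 2); [apply Rmult_le_compat_r; nra|].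
apply Rmult_le_compat_l; nra.
Qed.

(** The two expansions force [c1 - coef1 p s (h z)] to be of order [z], and this
    difference is continuous at 0. *)
Lemma coef_of_expansion (p : R) (s : C) (h phi : C -> C) (c0 c1 : C) :
  0 < p < 1 -> Cmod s <= 1 -> Ccont h 0 -> (forall z, Cmod z < 1 -> Cmod (h z) <= 1) ->
  (forall z, Cmod z < 1 -> phi z = Phi p s (h z) z) ->
  has_expansion 1 phi (c0, c1) -> c0 = coef0 p s /\ c1 = coef1 p s (h 0).
Proof.
intros Hp Hs Hc Hh Hphi H.
assert (E0 : c0 = coef0 p s).
{ rewrite (expansion_0_value phi c0 (expansion_1_0 _ _ _ H)), Hphi by (rewrite Cmod_0; lra).
  apply Phi_at_0; assumption. }
split; [exact E0|].
apply has_expansion_1_iff in H. destruct H as (M & d1 & Hd1 & H1).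
destruct (Phi_expansion p s h Hp Hs Hc Hh) as (K & d2 & Hd2 & H2).
apply (proj1 (Cminus_0_iff _ _)).
assert (Hd0 := coef_den p s Hp Hs).
apply (Ccont_zero_bound (fun z => c1 - coef1 p s (h z))%C).
{ unfold coef1. ccont. apply Cmult_neq_0; assumption. }
exists (M + K), (Rmin 1 (Rmin d1 d2)). split; [repeat apply Rmin_pos; lra|].
intros z Hz0 Hz.
assert (L : Cmod z < 1 /\ Cmod z < d1 /\ Cmod z < d2).
{ revert Hz. unfold Rmin. repeat destruct Rle_dec; intros; lra. }
destruct L as (L0 & L1 & L2). specialize (H1 z L1). specialize (H2 z L2).
rewrite (Hphi z L0), E0 in H1.
assert (P := Cmod_pos_lt z Hz0).
apply Rmult_le_reg_l with (Cmod z); [exact P|]. rewrite <- Cmod_mult.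
replace (z * (c1 - coef1 p s (h z)))%C
  with ((Phi p s (h z) z - (coef0 p s + z * coef1 p s (h z)))
        - (Phi p s (h z) z - (coef0 p s + z * c1)))%C by ring.
eapply Rle_trans; [apply Cmod_triangle_minus|]. nra.
Qed.

Lemma Phi_has_expansion (p : R) (s h : C) : 0 < p < 1 -> Cmod s <= 1 -> Cmod h <= 1 ->
  has_expansion 1 (Phi p s h) (coef0 p s, coef1 p s h).
Proof.
intros Hp Hs Hh. apply has_expansion_1_iff.
apply (Phi_expansion p s (fun _ => h) Hp Hs); [apply Ccont_const|intros; exact Hh].
Qed.

Lemma coef_body_1_param (p : R) (c0 c1 : C) : 0 < p < 1 ->
  coef_body 1 (B p) (c0, c1) <->
  exists s h, Cmod s <= 1 /\ Cmod h <= 1 /\ c0 = coef0 p s /\ c1 = coef1 p s h.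
Proof.
intros Hp. split.
- intros (phi & HB & Hexp).
  destruct (B_parametrization p phi Hp HB) as (s & h & E & Hs & [[Hc _] Hh] & Hphi).
  assert (H0 : Cmod 0 < 1) by (rewrite Cmod_0; lra).
  exists s, (h 0). split; [exact Hs|split; [apply Hh, H0|]].
  apply (coef_of_expansion p s h phi); try assumption. apply Hc, H0.
- intros (s & h & Hs & Hh & -> & ->). exists (Phi p s h).
  split; [apply Phi_in_B|apply Phi_has_expansion]; assumption.
Qed.

Lemma coef_body_0_param (p : R) (c0 : C) : 0 < p < 1 ->
  coef_body 0 (B p) c0 <-> exists s, Cmod s <= 1 /\ c0 = coef0 p s.
Proof.
intros Hp. split.
- intros (phi & HB & Hexp).
  destruct (B_parametrization p phi Hp HB) as (s & h & E & Hs & _ & Hphi).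
  exists s. split; [exact Hs|].
  rewrite (expansion_0_value phi c0 Hexp), Hphi by (rewrite Cmod_0; lra).
  apply Phi_at_0; assumption.
- intros (s & Hs & ->). exists (Phi p s 0).
  assert (H0 : Cmod 0 <= 1) by (rewrite Cmod_0; lra).
  split; [apply Phi_in_B; assumption|].
  apply (expansion_1_0 _ _ (coef1 p s 0)). apply Phi_has_expansion; assumption.
Qed.

(** * The two coordinate systems of the coefficient bodies *)

(** The parameter of the disk of centre and radius [/ P] filled by [c0]. *)
Definition sigma0_of (p : R) (s : C) : C := mobius (RtoC (p * p)) s.
(** The number multiplying [- h] has modulus 1: it is the phase lost when the
    square of the denominator of [coef1] is replaced by the square of its
    modulus. *)
Definition sigma1_of (p : R) (s h : C) : C :=
  (- h * ((1 - p * p * Cconj s) / (1 - p * p * s)))%C.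

Lemma Cmod_conj_den (p : R) (s : C) : Cmod (1 - p * p * Cconj s) = Cmod (1 - p * p * s).
Proof.
rewrite <- Cmod_conj. f_equal. rewrite Cminus_conj, !Cmult_conj, !Cconj_R, Cconj_conj. reflexivity.
Qed.

Lemma Cmod_sigma1 p s h : 0 < p < 1 -> Cmod s <= 1 -> Cmod (sigma1_of p s h) = Cmod h.
Proof.
intros Hp Hs. assert (Hd := coef_den p s Hp Hs). unfold sigma1_of.
rewrite Cmod_mult, Cmod_opp, Cmod_div, Cmod_conj_den by exact Hd.
assert (P := Cmod_pos_lt _ Hd). field. lra.
Qed.

Lemma Cmod_pp_lt_1 (p : R) : 0 < p < 1 -> Cmod (RtoC (p * p)) < 1.
Proof. intros Hp. rewrite Cmod_R, Rabs_pos_eq; nra. Qed.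

Lemma Cmod_mobius_eq_1 (b z : C) : Cmod b < 1 -> Cmod z <= 1 ->
  (Cmod (mobius b z) = 1 <-> Cmod z = 1).
Proof.
intros Hb Hz. split; intros H.
- destruct (Rle_lt_or_eq_dec _ _ Hz) as [Hlt|E]; [|exact E].
  assert (L := mobius_lt_1 b z Hb Hlt). lra.
- assert (Hd := mobius_den b z Hb Hz). assert (I := mobius_identity b z).
  rewrite H in I. unfold mobius. rewrite Cmod_div by exact Hd.
  assert (P := Cmod_pos_lt _ Hd).
  assert (E : Cmod (1 - Cconj b * z) = Cmod (z - b)).
  { apply Rle_antisym; apply Cmod_le_sqr; lra. }
  rewrite <- E. field. lra.
Qed.

Lemma P_pos (p P : R) (Hp : 0 < p < 1) (HP : P = p + / p) : 0 < P.
Proof. rewrite HP. assert (0 < / p) by (apply Rinv_0_lt_compat; lra). lra. Qed.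

Lemma RtoC_P (p P : R) (Hp : 0 < p < 1) (HP : P = p + / p) : RtoC P = ((1 + p * p) / p)%C.
Proof.
rewrite <- RtoC_mult, <- RtoC_plus, <- RtoC_div by lra. f_equal. rewrite HP. field. lra.
Qed.

Lemma pC_neq_0 (p : R) (Hp : 0 < p < 1) : RtoC p <> 0.
Proof. intros F. apply RtoC_inj in F. lra. Qed.
Lemma PC_neq_0 (p P : R) (Hp : 0 < p < 1) (HP : P = p + / p) : RtoC P <> 0.
Proof. intros F. apply RtoC_inj in F. assert (H := P_pos p P Hp HP). lra. Qed.
Lemma ppC_neq_0 (p : R) (Hp : 0 < p < 1) : (1 + p * p)%C <> 0.
Proof. rewrite <- RtoC_mult, <- RtoC_plus. intros F. apply RtoC_inj in F. nra. Qed.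

Lemma RtoC_Pinv (p P : R) (Hp : 0 < p < 1) (HP : P = p + / p) : RtoC (/ P) = (p / (1 + p * p))%C.
Proof.
assert (HP0 := P_pos p P Hp HP). assert (H1 := pC_neq_0 p Hp). assert (H2 := ppC_neq_0 p Hp).
rewrite RtoC_inv by lra. rewrite (RtoC_P p P Hp HP). field. split; assumption.
Qed.

Lemma coef0_sigma (p P : R) (Hp : 0 < p < 1) (HP : P = p + / p) (s : C) :
  Cmod s <= 1 -> coef0 p s = (RtoC (/ P) * (1 - sigma0_of p s))%C.
Proof.
intros Hs. assert (Hd := coef_den p s Hp Hs). assert (H2 := ppC_neq_0 p Hp).
rewrite (RtoC_Pinv p P Hp HP). unfold coef0, sigma0_of, mobius. rewrite Cconj_R, RtoC_mult.
field. split; assumption.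
Qed.

Lemma coef1_sigma (p P : R) (Hp : 0 < p < 1) (HP : P = p + / p) (s h : C) : Cmod s <= 1 ->
  coef1 p s h = (RtoC ((/ P) ^ 2)
     * (1 + RtoC (P ^ 2 - 2) * sigma0_of p s + sigma0_of p s ^ 2)
     + RtoC (/ P * (1 - Cmod (sigma0_of p s) ^ 2)) * sigma1_of p s h)%C.
Proof.
intros Hs. assert (Hd := coef_den p s Hp Hs). assert (H2 := ppC_neq_0 p Hp).
assert (H1 := pC_neq_0 p Hp).
assert (Hs' : Cmod (Cconj s) <= 1) by (rewrite Cmod_conj; exact Hs).
assert (Hd' := coef_den p (Cconj s) Hp Hs').
rewrite RtoC_mult, !RtoC_minus, Cmod_sqr_conj, !RtoC_pow, (RtoC_Pinv p P Hp HP), (RtoC_P p P Hp HP).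
assert (Ec : Cconj (sigma0_of p s) = ((Cconj s - p * p) / (1 - p * p * Cconj s))%C).
{ unfold sigma0_of, mobius. unfold Cdiv. rewrite Cmult_conj, Cinv_conj.
  - rewrite !Cminus_conj, !Cmult_conj, !Cconj_R, RtoC_mult. reflexivity.
  - rewrite Cconj_R, RtoC_mult. exact Hd. }
rewrite Ec. unfold sigma1_of, sigma0_of, mobius, coef1. rewrite Cconj_R, RtoC_mult.
set (t := Cconj s) in *. field. repeat split; assumption.
Qed.

Lemma sigma_surjective (p : R) (s0 s1 : C) : 0 < p < 1 -> Cmod s0 <= 1 -> Cmod s1 <= 1 ->
  exists s h, Cmod s <= 1 /\ Cmod h <= 1 /\ sigma0_of p s = s0 /\ sigma1_of p s h = s1.
Proof.
intros Hp H0 H1. assert (Hpp := Cmod_pp_lt_1 p Hp).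
set (s := mobius (- RtoC (p * p)) s0).
assert (Hs : Cmod s <= 1) by (apply mobius_le_1; [rewrite Cmod_opp; exact Hpp|exact H0]).
assert (Hs' : Cmod (Cconj s) <= 1) by (rewrite Cmod_conj; exact Hs).
assert (Hd := coef_den p s Hp Hs). assert (Hd' := coef_den p (Cconj s) Hp Hs').
set (h := (- s1 * ((1 - p * p * s) / (1 - p * p * Cconj s)))%C).
assert (E1 : sigma1_of p s h = s1) by (unfold sigma1_of, h; field; split; assumption).
exists s, h. split; [exact Hs|]. split; [|split; [|exact E1]].
- rewrite <- (Cmod_sigma1 p s h Hp Hs), E1. exact H1.
- apply mobius_cancel; assumption.
Qed.

Lemma coef_body_1_sigma (p P : R) (c0 c1 : C) : 0 < p < 1 -> P = p + / p ->
  coef_body 1 (B p) (c0, c1) <->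
      exists sigma0 sigma1 : C,
        closed_unit_disk sigma0 /\ closed_unit_disk sigma1 /\
        c0 = (RtoC (/ P) * (1 - sigma0))%C /\
        c1 = (RtoC ((/ P) ^ 2)
                * (1 + RtoC (P ^ 2 - 2) * sigma0 + sigma0 ^ 2)
              + RtoC (/ P * (1 - Cmod sigma0 ^ 2)) * sigma1)%C.
Proof.
intros Hp HP. rewrite (coef_body_1_param p c0 c1 Hp). split.
- intros (s & h & Hs & Hh & -> & ->). exists (sigma0_of p s), (sigma1_of p s h).
  split; [|split; [|split]].
  + apply mobius_le_1; [apply Cmod_pp_lt_1, Hp|exact Hs].
  + red. rewrite Cmod_sigma1; assumption.
  + apply coef0_sigma; assumption.
  + apply coef1_sigma; assumption.
- intros (s0 & s1 & H0 & H1 & -> & ->).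
  destruct (sigma_surjective p s0 s1 Hp H0 H1) as (s & h & Hs & Hh & <- & <-).
  exists s, h. repeat split; try assumption; symmetry.
  + apply coef0_sigma; assumption.
  + apply coef1_sigma; assumption.
Qed.

(** In the coordinate [s0], the centre and the radius of the disk in which [c1]
    varies. *)
Lemma sigma_center_radius (p P : R) (s0 : C) : 0 < p < 1 -> P = p + / p ->
  let c0 := (RtoC (/ P) * (1 - s0))%C in
  Cmod (c0 - RtoC (/ P)) = / P * Cmod s0 /\
  (1 - RtoC P * c0 + c0 ^ 2 = RtoC ((/ P) ^ 2) * (1 + RtoC (P ^ 2 - 2) * s0 + s0 ^ 2))%C /\
  P * ((/ P) ^ 2 - (Cmod (c0 - RtoC (/ P))) ^ 2) = / P * (1 - Cmod s0 ^ 2).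
Proof.
intros Hp HP c0. assert (HP0 := P_pos p P Hp HP). assert (HPC := PC_neq_0 p P Hp HP).
assert (E : Cmod (c0 - RtoC (/ P)) = / P * Cmod s0).
{ unfold c0. replace (RtoC (/ P) * (1 - s0) - RtoC (/ P))%C with (- (RtoC (/ P) * s0))%C by ring.
  rewrite Cmod_opp, Cmod_mult, Cmod_R, Rabs_pos_eq; [reflexivity|].
  left. apply Rinv_0_lt_compat, HP0. }
split; [exact E|split].
- unfold c0. rewrite RtoC_pow, RtoC_minus, RtoC_pow, RtoC_inv by lra. field. exact HPC.
- rewrite E. field. lra.
Qed.

(** For fixed [c0] the formula in [sigma1] describes a closed disk; its radius is
    nonnegative precisely when [|sigma0| <= 1]. *)
Lemma coef_body_1_ineq (p P : R) (c0 c1 : C) : 0 < p < 1 -> P = p + / p ->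
  coef_body 1 (B p) (c0, c1) <->
      Cmod (c1 - (1 - RtoC P * c0 + c0 ^ 2))
        <= P * ((/ P) ^ 2 - (Cmod (c0 - RtoC (/ P))) ^ 2).
Proof.
intros Hp HP. rewrite (coef_body_1_sigma p P c0 c1 Hp HP).
assert (HP0 := P_pos p P Hp HP). assert (HPC := PC_neq_0 p P Hp HP).
assert (HPi : 0 < / P) by (apply Rinv_0_lt_compat, HP0).
split.
- intros (s0 & s1 & H0 & H1 & E0 & E1).
  destruct (sigma_center_radius p P s0 Hp HP) as (_ & EQ & ER).
  cbv zeta in EQ, ER. rewrite <- E0 in EQ, ER. rewrite ER, EQ, E1.
  match goal with |- Cmod (?a + ?b - ?a)%C <= _ => replace (a + b - a)%C with b by ring end.
  rewrite Cmod_mult, Cmod_R. red in H0, H1. assert (A := Cmod_ge_0 s0).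
  assert (0 <= / P * (1 - Cmod s0 ^ 2)) by (apply Rmult_le_pos; nra).
  rewrite Rabs_pos_eq by assumption. nra.
- intros H. set (s0 := (1 - RtoC P * c0)%C).
  assert (E0 : c0 = (RtoC (/ P) * (1 - s0))%C).
  { unfold s0. rewrite RtoC_inv by lra. field. exact HPC. }
  destruct (sigma_center_radius p P s0 Hp HP) as (_ & EQ & ER).
  cbv zeta in EQ, ER. rewrite <- E0 in EQ, ER. rewrite ER, EQ in H.
  set (q := (RtoC ((/ P) ^ 2) * (1 + RtoC (P ^ 2 - 2) * s0 + s0 ^ 2))%C) in *.
  set (r := / P * (1 - Cmod s0 ^ 2)) in *.
  assert (Hr : 0 <= r) by (eapply Rle_trans; [apply Cmod_ge_0|exact H]).
  assert (Hs0 : Cmod s0 <= 1).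
  { assert (A := Cmod_ge_0 s0). apply Rnot_lt_le. intros Hlt.
    assert (/ P * (Cmod s0 ^ 2 - 1) > 0) by (apply Rmult_lt_0_compat; nra). unfold r in Hr. lra. }
  destruct (Rle_lt_or_eq_dec _ _ Hr) as [Hpos|Hz].
  + assert (HrC : RtoC r <> 0) by (intros F; apply RtoC_inj in F; lra).
    exists s0, ((c1 - q) / RtoC r)%C. split; [exact Hs0|split; [|split; [exact E0|]]].
    * red. rewrite Cmod_div, Cmod_R, Rabs_pos_eq by assumption.
      apply Rmult_le_reg_r with r; [exact Hpos|]. unfold Rdiv.
      rewrite Rmult_assoc, Rinv_l by lra. lra.
    * fold r. fold q. field. exact HrC.
  + exists s0, (RtoC 0). split; [exact Hs0|split; [|split; [exact E0|]]].
    * red. rewrite Cmod_0. lra.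
    * rewrite Cmult_0_r, Cplus_0_r. apply (proj1 (Cminus_0_iff _ _)).
      fold q. apply Cmod_eq_0. apply Rle_antisym; [lra|apply Cmod_ge_0].
Qed.

Lemma coef_body_0_ineq (p P : R) (c0 : C) : 0 < p < 1 -> P = p + / p ->
  coef_body 0 (B p) c0 <-> Cmod (c0 - RtoC (/ P)) <= / P.
Proof.
intros Hp HP. rewrite (coef_body_0_param p c0 Hp).
assert (HP0 := P_pos p P Hp HP). assert (HPC := PC_neq_0 p P Hp HP).
assert (HPi : 0 < / P) by (apply Rinv_0_lt_compat, HP0).
assert (H01 : Cmod 0 <= 1) by (rewrite Cmod_0; lra).
split.
- intros (s & Hs & ->). rewrite (coef0_sigma p P Hp HP s Hs).
  rewrite (proj1 (sigma_center_radius p P _ Hp HP)).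
  assert (L := mobius_le_1 (RtoC (p * p)) s (Cmod_pp_lt_1 p Hp) Hs).
  fold (sigma0_of p s) in L. nra.
- intros H. set (s0 := (1 - RtoC P * c0)%C).
  assert (E0 : c0 = (RtoC (/ P) * (1 - s0))%C).
  { unfold s0. rewrite RtoC_inv by lra. field. exact HPC. }
  assert (ER := proj1 (sigma_center_radius p P s0 Hp HP)). rewrite <- E0 in ER.
  assert (Hs0 : Cmod s0 <= 1).
  { rewrite ER in H. apply Rmult_le_reg_l with (/ P); lra. }
  destruct (sigma_surjective p s0 0 Hp Hs0 H01) as (s & _ & Hs & _ & E & _).
  exists s. split; [exact Hs|]. rewrite (coef0_sigma p P Hp HP s Hs), E. exact E0.
Qed.

(** * Boundaries of the coefficient bodies *)

(** A direction in which the modulus increases at unit speed; it leads out of a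
    closed disk from a boundary point, even when the radius is 0. *)
Lemma push_out (d : C) : exists u, Cmod u = 1 /\
  forall t, 0 <= t -> Cmod (d + RtoC t * u) = Cmod d + t.
Proof.
destruct (excluded_middle_informative (d = 0)) as [->|Hd].
- exists (RtoC 1). split; [apply Cmod_1|]. intros t Ht.
  rewrite Cmult_1_r, Cplus_0_l, Cmod_R, Cmod_0, Rabs_pos_eq; lra.
- assert (P := Cmod_pos_lt d Hd).
  exists (d / RtoC (Cmod d))%C.
  assert (HC : RtoC (Cmod d) <> 0) by (intros F; apply RtoC_inj in F; lra).
  split.
  + rewrite Cmod_div, Cmod_R, Rabs_pos_eq by (assumption || lra). field. lra.
  + intros t Ht. replace (d + t * (d / Cmod d))%C with (d * RtoC (1 + t / Cmod d))%C.
    2:{ rewrite RtoC_plus, RtoC_div by lra. field. exact HC. }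
    rewrite Cmod_mult, Cmod_R, Rabs_pos_eq.
    * field. lra.
    * assert (0 <= t / Cmod d) by (apply Rdiv_le_0_compat; lra). lra.
Qed.

Lemma C_ball_Cmod (x y : C) (eps : posreal) :
  ball (M := C_UniformSpace) x eps y -> Cmod (y - x) < 2 * eps.
Proof.
intros H. assert (L := C_NormedModule_mixin_compat2 x y eps H).
eapply Rlt_le_trans; [exact L|]. apply Rmult_le_compat_r; [left; apply cond_pos|].
assert (S := sqrt_le_1_alt 2 4). replace (sqrt 4) with 2 in S; [apply S; lra|].
replace 4 with (2 * 2) by ring. rewrite sqrt_square; lra.
Qed.

Lemma Cmod_C_ball (x y : C) (eps : R) : Cmod (y - x) < eps -> ball (M := C_UniformSpace) x eps y.
Proof. exact (C_NormedModule_mixin_compat1 x y eps). Qed.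

Lemma Cmod_minus_diag (x : C) : Cmod (x - x) = 0.
Proof. rewrite (proj2 (Cminus_0_iff x x) eq_refl). apply Cmod_0. Qed.

Lemma boundary_closed_disk (a : C) (r : R) (A : C -> Prop) (x : C) :
  (forall c, A c <-> Cmod (c - a) <= r) -> A x ->
  (boundary (T := C_UniformSpace) A x <-> Cmod (x - a) = r).
Proof.
intros HA Hx. assert (Hle := proj1 (HA x) Hx). split.
- intros Hb. destruct (Rle_lt_or_eq_dec _ _ Hle) as [Hlt|E]; [|exact E]. exfalso.
  assert (He : 0 < (r - Cmod (x - a)) / 2) by lra.
  destruct (Hb (mkposreal _ He)) as (_ & y & Hy & HnA). apply HnA, HA.
  apply C_ball_Cmod in Hy. simpl in Hy.
  assert (T := Cmod_triangle (y - x) (x - a)).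
  replace (y - x + (x - a))%C with (y - a)%C in T by ring. lra.
- intros E eps. split; [exists x; split; [apply ball_center|exact Hx]|].
  destruct (push_out (x - a)) as (u & Hu & Hp).
  assert (He := cond_pos eps).
  exists (x + RtoC (eps / 2) * u)%C. split.
  + apply Cmod_C_ball. replace (x + (eps / 2)%R * u - x)%C with (RtoC (eps / 2) * u)%C by ring.
    rewrite Cmod_mult, Hu, Cmod_R, Rabs_pos_eq; lra.
  + intros HAy. apply HA in HAy.
    replace (x + (eps / 2)%R * u - a)%C with (x - a + RtoC (eps / 2) * u)%C in HAy by ring.
    rewrite Hp in HAy by lra. lra.
Qed.

(** A family of closed disks over the plane, with centre [q c0] and radius [r c0]
    depending continuously on [c0].  From a boundary point of a fibre one leaves
    the set inside that fibre. *)
Lemma boundary_fibered_disk (q : C -> C) (r : C -> R) (A : C * C -> Prop) (x0 x1 : C) :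
  Ccont q x0 -> Ccont (fun c => RtoC (r c)) x0 ->
  (forall c0 c1, A (c0, c1) <-> Cmod (c1 - q c0) <= r c0) -> A (x0, x1) ->
  (boundary (T := Cspace 1) A (x0, x1) <-> Cmod (x1 - q x0) = r x0).
Proof.
intros Hq Hr HA Hx. assert (Hle := proj1 (HA _ _) Hx). split.
- intros Hb. destruct (Rle_lt_or_eq_dec _ _ Hle) as [Hlt|E]; [|exact E]. exfalso.
  set (e := (r x0 - Cmod (x1 - q x0)) / 4). assert (He : 0 < e) by (unfold e; lra).
  destruct (proj1 (Ccont_eps _ _) Hq e He) as (d1 & Hd1 & H1).
  destruct (proj1 (Ccont_eps _ _) Hr e He) as (d2 & Hd2 & H2).
  assert (Hd : 0 < Rmin e (Rmin d1 d2) / 2).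
  { assert (0 < Rmin e (Rmin d1 d2)) by (repeat apply Rmin_pos; assumption). lra. }
  destruct (Hb (mkposreal _ Hd)) as (_ & [y0 y1] & [B0 B1] & HnA). apply HnA, HA.
  apply C_ball_Cmod in B0, B1. simpl in B0, B1.
  assert (L : Cmod (y0 - x0) < d1 /\ Cmod (y0 - x0) < d2 /\ Cmod (y1 - x1) < e).
  { revert B0 B1. unfold Rmin. repeat destruct Rle_dec; intros; repeat split; lra. }
  destruct L as (L1 & L2 & L3).
  specialize (H1 y0 L1). specialize (H2 y0 L2).
  rewrite <- RtoC_minus, Cmod_R in H2. apply Rabs_def2 in H2.
  assert (T := Cmod_triangle (y1 - x1) (x1 - q x0)).
  assert (T2 := Cmod_triangle_minus (y1 - x1 + (x1 - q x0)) (q y0 - q x0)).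
  replace (y1 - x1 + (x1 - q x0) - (q y0 - q x0))%C with (y1 - q y0)%C in T2 by ring.
  unfold e in *. lra.
- intros E eps. split; [exists (x0, x1); split; [apply ball_center|exact Hx]|].
  destruct (push_out (x1 - q x0)) as (u & Hu & Hp).
  assert (He := cond_pos eps).
  exists (x0, (x1 + RtoC (eps / 2) * u)%C). split.
  + split; apply Cmod_C_ball; simpl.
    * rewrite Cmod_minus_diag. exact He.
    * replace (x1 + (eps / 2)%R * u - x1)%C with (RtoC (eps / 2) * u)%C by ring.
      rewrite Cmod_mult, Hu, Cmod_R, Rabs_pos_eq; lra.
  + intros HAy. apply HA in HAy.
    replace (x1 + (eps / 2)%R * u - q x0)%C with (x1 - q x0 + RtoC (eps / 2) * u)%C in HAy by ring.
    rewrite Hp in HAy by lra. lra.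
Qed.

Lemma Ccont_Cmod_sqr f z : Ccont f z -> Ccont (fun w => RtoC (Cmod (f w) ^ 2)) z.
Proof.
intros Hf. apply (Ccont_local (fun w => f w * Cconj (f w))%C _ z 1 Rlt_0_1).
{ intros w _. symmetry. apply Cmod_sqr_conj. }
apply (Ccont_mult f (fun w => Cconj (f w))); [exact Hf|].
apply Ccont_eps. intros eps Heps.
destruct (proj1 (Ccont_eps f z) Hf eps Heps) as (del & Hd & H). exists del. split; [exact Hd|].
intros w Hw. rewrite <- Cminus_conj, Cmod_conj. apply H, Hw.
Qed.

Lemma boundary_coef_body_0 (p : R) (s : C) : 0 < p < 1 -> Cmod s <= 1 ->
  (boundary (coef_body 0 (B p)) (coef0 p s) <-> Cmod s = 1).
Proof.
intros Hp Hs. set (P := p + / p). assert (HP : P = p + / p) by reflexivity.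
assert (HP0 := P_pos p P Hp HP). assert (HPi : 0 < / P) by (apply Rinv_0_lt_compat, HP0).
rewrite (boundary_closed_disk (RtoC (/ P)) (/ P) (coef_body 0 (B p))).
- rewrite (coef0_sigma p P Hp HP s Hs), (proj1 (sigma_center_radius p P _ Hp HP)).
  rewrite <- (Cmod_mobius_eq_1 (RtoC (p * p)) s (Cmod_pp_lt_1 p Hp) Hs).
  fold (sigma0_of p s). split; intros E; [|rewrite E; ring].
  apply Rmult_eq_reg_l with (/ P); lra.
- intros c. apply coef_body_0_ineq; assumption.
- apply coef_body_0_param; [exact Hp|]. exists s. split; [exact Hs|reflexivity].
Qed.

Lemma boundary_coef_body_1 (p : R) (s h : C) : 0 < p < 1 -> Cmod s <= 1 -> Cmod h <= 1 ->
  (boundary (coef_body 1 (B p)) (coef0 p s, coef1 p s h) <-> Cmod s = 1 \/ Cmod h = 1).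
Proof.
intros Hp Hs Hh. set (P := p + / p). assert (HP : P = p + / p) by reflexivity.
assert (HP0 := P_pos p P Hp HP). assert (HPi : 0 < / P) by (apply Rinv_0_lt_compat, HP0).
rewrite (boundary_fibered_disk (fun c0 => 1 - RtoC P * c0 + c0 ^ 2)%C
  (fun c0 => P * ((/ P) ^ 2 - (Cmod (c0 - RtoC (/ P))) ^ 2)) (coef_body 1 (B p))).
- rewrite (coef1_sigma p P Hp HP s h Hs), (coef0_sigma p P Hp HP s Hs).
  destruct (sigma_center_radius p P (sigma0_of p s) Hp HP) as (_ & EQ & ER).
  cbv zeta in EQ, ER. rewrite EQ, ER.
  match goal with |- Cmod (?a + ?b - ?a)%C = _ <-> _ => replace (a + b - a)%C with b by ring end.
  rewrite Cmod_mult, Cmod_R, Cmod_sigma1 by assumption.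
  rewrite <- (Cmod_mobius_eq_1 (RtoC (p * p)) s (Cmod_pp_lt_1 p Hp) Hs).
  fold (sigma0_of p s).
  assert (L : Cmod (sigma0_of p s) <= 1) by (apply mobius_le_1; [apply Cmod_pp_lt_1, Hp|exact Hs]).
  set (x := Cmod (sigma0_of p s)) in *. assert (A : 0 <= x) by apply Cmod_ge_0.
  assert (Hx : 0 <= / P * (1 - x ^ 2)) by (apply Rmult_le_pos; nra).
  rewrite Rabs_pos_eq by exact Hx. split.
  + intros E. destruct (Rle_lt_or_eq_dec _ _ L) as [Hlt|E2]; [right|left; exact E2].
    assert (0 < / P * (1 - x ^ 2)) by (apply Rmult_lt_0_compat; nra).
    apply Rmult_eq_reg_l with (/ P * (1 - x ^ 2)); lra.
  + intros [->| ->]; ring.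
- apply (Ccont_plus (fun c => 1 - RtoC P * c)%C (fun c => c ^ 2)%C).
  + ccont.
  + apply Ccont_pow, Ccont_id.
- apply (Ccont_local (fun c => RtoC P
      * (RtoC ((/ P) ^ 2) - RtoC (Cmod (c - RtoC (/ P)) ^ 2)))%C _ _ 1 Rlt_0_1).
  { intros w _. rewrite RtoC_mult, RtoC_minus. reflexivity. }
  apply (Ccont_mult (fun _ => RtoC P)); [apply Ccont_const|].
  apply (Ccont_minus (fun _ => RtoC ((/ P) ^ 2))
    (fun c => RtoC (Cmod (c - RtoC (/ P)) ^ 2))); [apply Ccont_const|].
  apply (Ccont_Cmod_sqr (fun c => c - RtoC (/ P))%C). ccont.
- intros c0 c1. apply coef_body_1_ineq; assumption.
- apply coef_body_1_param; [exact Hp|]. exists s, h. repeat split; assumption.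
Qed.

(** * Automorphisms and Blaschke products of degree two *)

Lemma mobius_opp_unimodular (s w : C) : Cmod s = 1 -> Cmod w < 1 -> mobius (- s) w = s.
Proof.
intros Hs Hw. destruct (mobius_opp_closed s w (Req_le _ _ Hs) Hw) as (Hd & -> & _).
assert (E : (s * Cconj s)%C = 1) by (rewrite <- Cmod_sqr_conj, Hs; f_equal; ring).
transitivity ((s + s * Cconj s * w - w * (s * Cconj s - 1)) / (1 + Cconj s * w))%C.
- apply (f_equal2 Cdiv); ring_simplify; reflexivity.
- rewrite E. replace (s + 1 * w - w * (1 - 1))%C with (s + 1 * w)%C by ring.
  transitivity (s * (1 + Cconj s * w) / (1 + Cconj s * w))%C; [|field; exact Hd].
  apply (f_equal2 Cdiv); [|reflexivity].
  replace (s * (1 + Cconj s * w))%C with (s + s * Cconj s * w)%C by ring. rewrite E. reflexivity.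
Qed.

Lemma mobius_opp_0 (s : C) : mobius (- s) 0 = s.
Proof. unfold mobius. rewrite Cmult_0_r. field. Qed.

(** If [psi] inverts [phi], Schwarz's lemma for both maps forces equality, and
    [|s|] is the quotient of the two sides at the origin.  Conversely, if
    [|s| = 1] then [mobius p] conjugates [phi] to the rotation by [s], whose
    inverse is the rotation by [Cconj s]. *)
Lemma automorphism_iff (p : R) (phi : C -> C) (s : C) (h : C -> C) : 0 < p < 1 ->
  B p phi -> Cmod s <= 1 -> (forall z, Cmod z < 1 -> Cmod (h z) <= 1) ->
  (forall z, Cmod z < 1 -> phi z = Phi p s (h z) z) ->
  (disk_automorphism phi <-> Cmod s = 1).
Proof.
intros Hp HB Hs Hh Hphi. assert (Hp1 := Cmod_real_lt_1 p Hp).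
assert (H0 : Cmod 0 < 1) by (rewrite Cmod_0; lra).
assert (Hm : forall z, Cmod z < 1 ->
  mobius p (phi z) = (mobius p z * mobius (- s) (h z * z))%C).
{ intros z Hz. rewrite (Hphi z Hz). apply Phi_mobius; try assumption. apply Hh, Hz. }
split.
- intros [_ (psi & Hpsi & Hinv)].
  assert (HBpsi : B p psi).
  { split; [exact Hpsi|]. rewrite <- (proj2 HB) at 1. apply Hinv, Hp1. }
  destruct (B_parametrization p psi Hp HBpsi) as (s' & h' & E' & Hs' & [_ Hh'] & Hpsi').
  set (w := phi 0). assert (Hw : Cmod w < 1) by (apply (proj2 (proj1 HB)); exact H0).
  assert (E1 : mobius p w = (mobius p 0 * s)%C).
  { unfold w. rewrite (Hm 0 H0). rewrite Cmult_0_r, mobius_opp_0. reflexivity. }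
  assert (E2 : mobius p 0 = (mobius p w * mobius (- s') (h' w * w))%C).
  { rewrite <- Phi_mobius by (try assumption; apply Hh', Hw).
    rewrite <- (Hpsi' w Hw). f_equal. symmetry. apply Hinv, H0. }
  destruct (mobius_opp_closed s' (h' w * w) Hs') as (_ & _ & L).
  { apply Cmod_mult_lt_1; [apply Hh', Hw|exact Hw]. }
  rewrite E1 in E2. apply (f_equal Cmod) in E2. rewrite !Cmod_mult in E2.
  assert (Hne : 0 < Cmod (mobius p 0)).
  { apply Cmod_pos_lt. unfold mobius. rewrite Cmult_0_r. intros F.
    assert (G : (- RtoC p)%C = 0) by (rewrite <- F; field).
    rewrite <- RtoC_opp in G. apply RtoC_inj in G. lra. }
  apply Rle_antisym; [exact Hs|].
  assert (A := Cmod_ge_0 s). assert (A' := Cmod_ge_0 (mobius (- s') (h' w * w))).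
  apply Rmult_le_reg_l with (Cmod (mobius p 0)); [exact Hne|].
  assert (0 <= Cmod (mobius p 0) * Cmod s) by (apply Rmult_le_pos; lra). nra.
- intros Hs1. split; [exact (proj1 HB)|].
  assert (Hs2 : Cmod (Cconj s) = 1) by (rewrite Cmod_conj; exact Hs1).
  assert (H01 : Cmod 0 <= 1) by lra.
  exists (Phi p (Cconj s) 0). destruct (Phi_in_B p (Cconj s) 0 Hp (Req_le _ _ Hs2) H01) as [Hhol _].
  split; [exact Hhol|].
  assert (E : (s * Cconj s)%C = 1) by (rewrite <- Cmod_sqr_conj, Hs1; f_equal; ring).
  assert (Hinj : forall x y, Cmod x < 1 -> Cmod y < 1 -> mobius p x = mobius p y -> x = y).
  { intros x y Hx Hy F. rewrite <- (mobius_cancel_opp p x), <- (mobius_cancel_opp p y) by lra.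
    rewrite F. reflexivity. }
  assert (M1 : forall z, Cmod z < 1 -> mobius p (phi z) = (mobius p z * s)%C).
  { intros z Hz. rewrite (Hm z Hz), mobius_opp_unimodular; [reflexivity|exact Hs1|].
    apply Cmod_mult_lt_1; [apply Hh, Hz|exact Hz]. }
  assert (M2 : forall z, Cmod z < 1 -> mobius p (Phi p (Cconj s) 0 z) = (mobius p z * Cconj s)%C).
  { intros z Hz. rewrite Phi_mobius by (try assumption; lra).
    rewrite Cmult_0_l, mobius_opp_0. reflexivity. }
  intros z Hz. red in Hz.
  assert (Hz1 : Cmod (phi z) < 1) by (apply (proj2 (proj1 HB)); exact Hz).
  assert (Hz2 : Cmod (Phi p (Cconj s) 0 z) < 1) by (apply (proj2 Hhol); exact Hz).
  split; apply Hinj.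
  + apply (proj2 Hhol). exact Hz1.
  + exact Hz.
  + rewrite (M2 _ Hz1), (M1 z Hz), <- Cmult_assoc, E. ring.
  + apply (proj2 (proj1 HB)). exact Hz2.
  + exact Hz.
  + rewrite (M1 _ Hz2), (M2 z Hz), <- Cmult_assoc, (Cmult_comm (Cconj s)), E. ring.
Qed.

Lemma Csqrt_exists (w : C) : exists r : C, (r * r = w)%C.
Proof.
destruct w as [x y]. set (m := Cmod (x, y)).
assert (Hm2 : m ^ 2 = x ^ 2 + y ^ 2) by apply Cmod2_alt.
assert (Hm : 0 <= m) by apply Cmod_ge_0.
assert (Hx : Rabs x <= m) by exact (Rabs_fst_le (x, y)).
apply Rabs_le_between in Hx.
assert (U : sqrt ((m + x) / 2) * sqrt ((m + x) / 2) = (m + x) / 2) by (apply sqrt_sqrt; lra).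
assert (V : sqrt ((m - x) / 2) * sqrt ((m - x) / 2) = (m - x) / 2) by (apply sqrt_sqrt; lra).
assert (UV : sqrt ((m + x) / 2) * sqrt ((m - x) / 2) = Rabs y / 2).
{ rewrite <- sqrt_mult_alt by lra.
  replace ((m + x) / 2 * ((m - x) / 2)) with (Rsqr (y / 2)) by (unfold Rsqr; nra).
  rewrite sqrt_Rsqr_abs. unfold Rdiv. rewrite Rabs_mult, (Rabs_pos_eq (/ 2)); lra. }
set (u := sqrt ((m + x) / 2)) in *. set (v := sqrt ((m - x) / 2)) in *.
destruct (Rle_lt_dec 0 y) as [Hy|Hy].
- rewrite Rabs_pos_eq in UV by exact Hy. exists (u, v). unfold Cmult; simpl. f_equal; lra.
- rewrite Rabs_left in UV by exact Hy. exists (u, - v). unfold Cmult; simpl. f_equal; lra.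
Qed.

Lemma quadratic_roots (n2 n1 n0 : C) : n2 <> 0 -> exists a b : C,
  (n1 = - (n2 * (a + b)))%C /\ (n0 = n2 * (a * b))%C.
Proof.
intros Hn. destruct (Csqrt_exists (n1 * n1 - 4 * n2 * n0)%C) as [r Hr].
exists ((- n1 + r) / (2 * n2))%C, ((- n1 - r) / (2 * n2))%C. split.
- field. exact Hn.
- transitivity ((n1 * n1 - r * r) / (4 * n2))%C.
  + rewrite Hr. field. exact Hn.
  + field. exact Hn.
Qed.

(** Outside the disk each factor of the first product dominates the corresponding
    factor of the second one, which carries the additional weight [p < 1]. *)
Lemma Phi_numerator_root (p : R) (s h a : C) : 0 < p < 1 -> Cmod s < 1 -> Cmod h = 1 ->
  ((a - p) * (s + h * a) + p * ((1 - p * a) * (1 + Cconj s * (h * a))) = 0)%C ->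
  Cmod a < 1.
Proof.
intros Hp Hs Hh H. apply Rnot_le_lt. intros Ha. assert (Hp1 := Cmod_real_lt_1 p Hp).
set (x := Cmod (a - p)) in *. set (y := Cmod (s + h * a)).
set (x' := Cmod (1 - p * a)). set (y' := Cmod (1 + Cconj s * (h * a))).
assert (Hx : x' <= x).
{ apply Cmod_le_sqr. assert (I := mobius_identity p a). rewrite Cconj_R in I.
  assert (A := Cmod_ge_0 p). assert (0 <= (1 - Cmod p ^ 2) * (Cmod a ^ 2 - 1)) by (apply Rmult_le_pos; nra).
  lra. }
assert (Hy : y' <= y).
{ apply Cmod_le_sqr. assert (I := mobius_identity (- s) (h * a)).
  rewrite Copp_conj, Cmod_opp, Cmod_mult, Hh, Rmult_1_l in I.
  replace (1 - - Cconj s * (h * a))%C with (1 + Cconj s * (h * a))%C in I by ring.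
  replace (h * a - - s)%C with (s + h * a)%C in I by ring.
  assert (A := Cmod_ge_0 s). assert (0 <= (1 - Cmod s ^ 2) * (Cmod a ^ 2 - 1)) by (apply Rmult_le_pos; nra).
  lra. }
assert (E : x * y = p * (x' * y')).
{ unfold x, y, x', y'. rewrite <- !Cmod_mult.
  replace ((a - p) * (s + h * a))%C
    with ((a - p) * (s + h * a) + p * ((1 - p * a) * (1 + Cconj s * (h * a)))
          - p * ((1 - p * a) * (1 + Cconj s * (h * a))))%C by ring.
  rewrite H. unfold Cminus. rewrite Cplus_0_l, Cmod_opp, Cmod_mult, Cmod_R, Rabs_pos_eq; lra. }
assert (A1 : 0 <= x') by apply Cmod_ge_0. assert (A2 : 0 <= y') by apply Cmod_ge_0.
assert (X : 0 < x).
{ assert (T := Cmod_triangle_rev a p). unfold x. lra. }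
assert (Y : 0 < y).
{ assert (T := Cmod_triangle_rev (h * a) (- s)). rewrite Cmod_opp, Cmod_mult, Hh in T.
  replace (h * a - - s)%C with (s + h * a)%C in T by ring. unfold y. lra. }
assert (0 < x * y) by (apply Rmult_lt_0_compat; assumption).
assert (x' * y' <= x * y) by (apply Rmult_le_compat; assumption). nra.
Qed.

(** For [|h| = 1] the denominator of [Phi] is, up to the factor [h], the numerator
    with its coefficients conjugated and reversed; a factorization of the latter
    therefore yields one of the former, with the roots reflected in the circle. *)
Lemma Phi_blaschke (p : R) (s h : C) : 0 < p < 1 -> Cmod s < 1 -> Cmod h = 1 ->
  blaschke_product 2 (Phi p s h).
Proof.
intros Hp Hs Hh. assert (Hp1 := Cmod_real_lt_1 p Hp).
assert (Ehh : (h * Cconj h)%C = 1) by (rewrite <- Cmod_sqr_conj, Hh; f_equal; ring).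
assert (Hh0 : h <> 0) by (intros F; rewrite F, Cmod_0 in Hh; lra).
assert (Hs' : Cmod (Cconj s) <= 1) by (rewrite Cmod_conj; lra).
assert (Hn2' := coef_den p (Cconj s) Hp Hs').
set (n2 := (h * (1 - p * p * Cconj s))%C).
assert (Hn2 : n2 <> 0) by (apply Cmult_neq_0; assumption).
set (n1 := (s - p * h + p * (Cconj s * h - p))%C). set (n0 := (p - p * s)%C).
destruct (quadratic_roots n2 n1 n0 Hn2) as (a & b & E1 & E0).
assert (EN : forall z, ((z - p) * (s + h * z) + p * ((1 - p * z) * (1 + Cconj s * (h * z)))
   = n2 * ((z - a) * (z - b)))%C).
{ intros z. transitivity (n2 * z * z + n1 * z + n0)%C; [unfold n2, n1, n0; ring|].
  rewrite E1, E0. ring. }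
assert (ED : forall z, ((1 - p * z) * (1 + Cconj s * (h * z)) + p * ((z - p) * (s + h * z))
   = h * Cconj n2 * ((1 - Cconj a * z) * (1 - Cconj b * z)))%C).
{ intros z. apply (f_equal Cconj) in E1, E0.
  rewrite Copp_conj, !Cmult_conj, Cplus_conj in E1. rewrite !Cmult_conj in E0.
  transitivity (h * (Cconj n2 + (- (Cconj n2 * (Cconj a + Cconj b))) * z
    + Cconj n2 * (Cconj a * Cconj b) * z * z))%C; [|ring].
  rewrite <- E1, <- E0. unfold n2, n1, n0.
  rewrite ?Cplus_conj, ?Cminus_conj, ?Cmult_conj, ?Cminus_conj, ?Cmult_conj, ?Cconj_conj, !Cconj_R.
  set (t := Cconj s). set (k := Cconj h) in *.
  transitivity ((h * k) * (1 - p * p * s) + (h * t - (h * k) * p + p * (s * (h * k) - h * p)) * z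
     + h * (p - p * t) * z * z)%C; [rewrite Ehh; ring|ring]. }
assert (Ha : Cmod a < 1).
{ apply (Phi_numerator_root p s h a Hp Hs Hh). rewrite EN. ring. }
assert (Hb : Cmod b < 1).
{ apply (Phi_numerator_root p s h b Hp Hs Hh). rewrite EN. ring. }
assert (Hcn : Cconj n2 <> 0).
{ apply Cmod_gt_0. rewrite Cmod_conj. apply Cmod_gt_0. exact Hn2. }
exists (n2 / (h * Cconj n2))%C, (a :: b :: nil). split; [|split; [reflexivity|split]].
- rewrite Cmod_div, Cmod_mult, Cmod_conj, Hh by (apply Cmult_neq_0; assumption).
  assert (P := Cmod_pos_lt n2 Hn2). field. lra.
- repeat constructor; assumption.
- intros z Hz. red in Hz.
  destruct (Phi_rational p s h z Hp (Rlt_le _ _ Hs) (Req_le _ _ Hh) Hz) as [_ E].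
  cbv zeta in E. rewrite E, EN, ED. simpl.
  assert (Da := mobius_den a z Ha (Rlt_le _ _ Hz)).
  assert (Db := mobius_den b z Hb (Rlt_le _ _ Hz)).
  field. repeat split; assumption.
Qed.

(** Write [phi] as [N / N']: the polynomials [N - p N'] and [N' - p N] are, up to
    conjugation, reversals of one another and share the factor coming from the
    fixed point [p].  Cancelling it leaves a quotient of affine functions, in which
    [h] can be computed at any point other than 0 and [p]: it is
    [al / (zeta * Cconj al)]. *)
Lemma blaschke_unimodular (p : R) (phi : C -> C) (s : C) (h : C -> C) (E : list C) :
  0 < p < 1 -> B p phi -> Cmod s < 1 -> schur_off E h ->
  (forall z, Cmod z < 1 -> phi z = Phi p s (h z) z) ->
  blaschke_product 2 phi -> Cmod (h 0) = 1.
Proof.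
intros Hp HB Hs Hsch Hphi (zeta & zeros & Hzeta & Hlen & Hall & Hbl).
destruct zeros as [|a [|b [|]]]; simpl in Hlen; try discriminate. clear Hlen.
apply Forall_cons_iff in Hall. destruct Hall as [Ha Hall].
apply Forall_cons_iff in Hall. destruct Hall as [Hb _]. red in Ha, Hb.
assert (Hp1 := Cmod_real_lt_1 p Hp).
assert (H0 : Cmod 0 < 1) by (rewrite Cmod_0; lra).
assert (Ezz : (zeta * Cconj zeta)%C = 1) by (rewrite <- Cmod_sqr_conj, Hzeta; f_equal; ring).
set (N := fun z => (zeta * ((z - a) * (z - b)))%C).
set (N' := fun z => ((1 - Cconj a * z) * (1 - Cconj b * z))%C).
assert (HN : forall z, Cmod z < 1 -> N' z <> 0 /\ (phi z * N' z = N z)%C).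
{ intros z Hz. assert (Da := mobius_den a z Ha (Rlt_le _ _ Hz)).
  assert (Db := mobius_den b z Hb (Rlt_le _ _ Hz)).
  split; [apply Cmult_neq_0; assumption|]. rewrite (Hbl z Hz). simpl. unfold N, N'.
  field. split; assumption. }
(* Comparison of the Blaschke formula with the one of [Phi], denominators
   cleared. *)
assert (Hcross : forall z, Cmod z < 1 ->
  ((N z - p * N' z) * ((1 - p * z) * (1 + Cconj s * (h z * z)))
   = (N' z - p * N z) * ((z - p) * (s + h z * z)))%C).
{ intros z Hz. destruct (HN z Hz) as [_ E1].
  destruct (Phi_rational p s (h z) z Hp (Rlt_le _ _ Hs) (proj2 Hsch z Hz) Hz) as [D2 E2].
  cbv zeta in D2, E2. rewrite <- (Hphi z Hz) in E2.
  set (X := ((z - p) * (s + h z * z))%C) in *.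
  set (Y := ((1 - p * z) * (1 + Cconj s * (h z * z)))%C) in *.
  assert (E3 : (phi z * (Y + p * X) = X + p * Y)%C) by (rewrite E2; field; exact D2).
  rewrite <- E1. 
  transitivity (N' z * (phi z * (Y + p * X) - p * phi z * X - p * Y))%C; [ring|].
  rewrite E3. ring. }
set (al := (zeta - p * Cconj a * Cconj b)%C).
set (be := (- (zeta * (a + b)) + p * (Cconj a + Cconj b) + p * al)%C).
assert (Hfix : (zeta * ((p - a) * (p - b)) - p * ((1 - Cconj a * p) * (1 - Cconj b * p)) = 0)%C).
{ destruct (HN p Hp1) as [_ E1]. rewrite (proj2 HB) in E1. unfold N, N' in E1.
  rewrite <- E1. ring. }
assert (EQ : forall z, (N z - p * N' z = (z - p) * (al * z + be))%C).
{ intros z. transitivity ((z - p) * (al * z + be) +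
    (zeta * ((p - a) * (p - b)) - p * ((1 - Cconj a * p) * (1 - Cconj b * p))))%C.
  - unfold N, N', be, al. ring.
  - rewrite Hfix. ring. }
assert (EQ' : forall z, (N' z - p * N z = zeta * ((1 - p * z) * (Cconj al + Cconj be * z)))%C).
{ intros z.
  assert (Hfix' := f_equal Cconj Hfix).
  rewrite Cminus_conj, !Cmult_conj, !Cminus_conj, !Cmult_conj, !Cconj_conj, !Cconj_R in Hfix'.
  assert (Eal : Cconj al = (Cconj zeta - p * a * b)%C).
  { unfold al. rewrite Cminus_conj, !Cmult_conj, !Cconj_conj, Cconj_R. reflexivity. }
  assert (Ebe : Cconj be = (- (Cconj zeta * (Cconj a + Cconj b)) + p * (a + b) + p * Cconj al)%C).
  { unfold be. rewrite !Cplus_conj, Copp_conj, !Cmult_conj, !Cplus_conj, !Cconj_conj, Cconj_R. reflexivity. }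
  rewrite Ebe, Eal. unfold N, N'.
  set (k := Cconj zeta) in *. set (a' := Cconj a) in *. set (b' := Cconj b) in *.
  transitivity (zeta * k * ((1 - a' * z) * (1 - b' * z)) - p * (zeta * ((z - a) * (z - b))))%C.
  - rewrite Ezz. ring.
  - transitivity (zeta * ((1 - p * z) * (k - p * a * b
        + (- (k * (a' + b')) + p * (a + b) + p * (k - p * a * b)) * z))
      + zeta * z * z * (k * ((p - a') * (p - b')) - p * ((1 - a * p) * (1 - b * p))))%C; [ring|].
    rewrite Hfix'. ring. }
assert (Hline : forall z : C, Cmod z < 1 -> z <> RtoC p ->
  ((al * z + be) * (1 + Cconj s * (h z * z)) = zeta * (Cconj al + Cconj be * z) * (s + h z * z))%C).
{ intros z Hz Hzp. assert (H := Hcross z Hz). rewrite EQ, EQ' in H.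
  assert (D1 : (z - p)%C <> 0) by (apply Cminus_neq_0, Hzp).
  assert (D2 := mobius_den p z Hp1 (Rlt_le _ _ Hz)). rewrite Cconj_R in D2.
  apply (f_equal (fun w => w / ((z - p) * (1 - p * z)))%C) in H.
  transitivity ((z - p) * (al * z + be) * ((1 - p * z) * (1 + Cconj s * (h z * z)))
     / ((z - p) * (1 - p * z)))%C; [field; split; assumption|].
  rewrite H. field. split; assumption. }
assert (Hal : al <> 0).
{ intros F. apply (proj1 (Cminus_0_iff _ _)) in F. apply (f_equal Cmod) in F.
  rewrite Hzeta, !Cmod_mult, !Cmod_conj, Cmod_R, Rabs_pos_eq in F by lra.
  assert (A := Cmod_ge_0 a). assert (A' := Cmod_ge_0 b).
  assert (Cmod a * Cmod b <= 1) by nra. nra. }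
assert (Hbe : be = (zeta * Cconj al * s)%C).
{ assert (H := Hline 0 H0). rewrite !Cmult_0_r, !Cplus_0_r, Cplus_0_l, Cmult_1_r in H.
  apply H. intros F. apply RtoC_inj in F. lra. }
assert (Hbe' : (al * Cconj s = zeta * Cconj be)%C).
{ rewrite Hbe, !Cmult_conj, Cconj_conj.
  transitivity (zeta * Cconj zeta * al * Cconj s)%C; [rewrite Ezz; ring|ring]. }
(* Any point of the disk other than 0 and [p]. *)
set (z0 := RtoC (- (p / 2))).
assert (Hz0 : Cmod z0 < 1) by (unfold z0; rewrite Cmod_R, Rabs_left; lra).
assert (Hz00 : z0 <> 0) by (intros F; apply RtoC_inj in F; lra).
assert (Hz0p : z0 <> RtoC p) by (intros F; apply RtoC_inj in F; lra).
assert (Hh : (h z0 * (zeta * Cconj al) = al)%C).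
{ assert (H := Hline z0 Hz0 Hz0p). set (w := h z0) in *.
  assert (H2 : ((1 - s * Cconj s) * (w * (zeta * Cconj al) - al) * z0 = 0)%C).
  { transitivity (zeta * (Cconj al + Cconj be * z0) * (s + w * z0)
      - (al * z0 + be) * (1 + Cconj s * (w * z0)))%C.
    - replace (zeta * (Cconj al + Cconj be * z0) * (s + w * z0))%C
        with (zeta * Cconj al * s + zeta * Cconj al * w * z0
              + (zeta * Cconj be) * z0 * (s + w * z0))%C by ring.
      rewrite <- Hbe', Hbe. ring.
    - rewrite H. ring. }
  assert (Ds : (1 - s * Cconj s)%C <> 0).
  { rewrite Cmult_comm. apply mobius_den; lra. }
  apply (proj1 (Cminus_0_iff _ _)). 
  destruct (excluded_middle_informative ((w * (zeta * Cconj al) - al)%C = 0)) as [E0|Hne]; [exact E0|].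
  exfalso. revert H2. apply Cmult_neq_0; [apply Cmult_neq_0|]; assumption. }
assert (Hmod : Cmod (h z0) = 1).
{ apply (f_equal Cmod) in Hh. rewrite !Cmod_mult, Cmod_conj, Hzeta in Hh.
  assert (P := Cmod_pos_lt al Hal). apply Rmult_eq_reg_r with (Cmod al); lra. }
rewrite (strong_max E h z0 0 Hsch Hz0 Hmod H0). exact Hmod.
Qed.

(** * The coefficient bodies and their extremal functions *)

Theorem theorem1 : forall p P : R, 0 < p < 1 -> P = p + / p ->
  (* (i) *)
  ((forall c0 : C,
      coef_body 0 (B p) c0 <-> Cmod (c0 - RtoC (/ P)) <= / P) /\
   (forall (phi : C -> C) (c0 : C),
      B p phi -> has_expansion 0 phi c0 ->
      (boundary (coef_body 0 (B p)) c0 <-> disk_automorphism phi))) /\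
  (* (ii) *)
  ((forall c0 c1 : C,
      coef_body 1 (B p) (c0, c1) <->
      Cmod (c1 - (1 - RtoC P * c0 + c0 ^ 2))
        <= P * ((/ P) ^ 2 - (Cmod (c0 - RtoC (/ P))) ^ 2)) /\
   (forall c0 c1 : C,
      coef_body 1 (B p) (c0, c1) <->
      exists sigma0 sigma1 : C,
        closed_unit_disk sigma0 /\ closed_unit_disk sigma1 /\
        c0 = (RtoC (/ P) * (1 - sigma0))%C /\
        c1 = (RtoC ((/ P) ^ 2)
                * (1 + RtoC (P ^ 2 - 2) * sigma0 + sigma0 ^ 2)
              + RtoC (/ P * (1 - Cmod sigma0 ^ 2)) * sigma1)%C) /\
   (forall (phi : C -> C) (c0 c1 : C),
      B p phi -> has_expansion 1 phi (c0, c1) ->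
      (boundary (coef_body 1 (B p)) (c0, c1) <->
       disk_automorphism phi \/ blaschke_product 2 phi))).
Proof.
intros p P Hp HP. assert (H0 : Cmod 0 < 1) by (rewrite Cmod_0; lra).
split; [split|split; [|split]].
- intros c0. apply coef_body_0_ineq; assumption.
- intros phi c0 HB Hexp.
  destruct (B_parametrization p phi Hp HB) as (s & h & E & Hs & Hh & Hphi).
  assert (Ec0 : c0 = coef0 p s).
  { rewrite (expansion_0_value phi c0 Hexp), (Hphi 0 H0). apply Phi_at_0; assumption. }
  rewrite Ec0, (boundary_coef_body_0 p s Hp Hs).
  symmetry. apply (automorphism_iff p phi s h); try assumption. apply Hh.
- intros c0 c1. apply coef_body_1_ineq; assumption.
- intros c0 c1. apply coef_body_1_sigma; assumption.
- intros phi c0 c1 HB Hexp.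
  destruct (B_parametrization p phi Hp HB) as (s & h & E & Hs & Hh & Hphi).
  assert (Hh0 : Cmod (h 0) <= 1) by (apply Hh, H0).
  destruct (coef_of_expansion p s h phi c0 c1) as [-> ->]; try assumption.
  { apply (proj1 Hh), H0. }
  { apply Hh. }
  rewrite (boundary_coef_body_1 p s (h 0) Hp Hs Hh0).
  rewrite (automorphism_iff p phi s h) by (assumption || apply Hh).
  destruct (Rle_lt_or_eq_dec _ _ Hs) as [Hlt|Heq]; [|tauto].
  assert (Hiff : Cmod (h 0) = 1 <-> blaschke_product 2 phi); [|tauto].
  split.
  + intros H1.
    destruct (Phi_blaschke p s (h 0) Hp Hlt H1) as (zeta & zeros & Hz1 & Hz2 & Hz3 & Hz4).
    exists zeta, zeros. split; [exact Hz1|split; [exact Hz2|split; [exact Hz3|]]].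
    intros z Hz. rewrite (Hphi z Hz), (strong_max E h 0 z Hh H0 H1 Hz). apply Hz4, Hz.
  + apply (blaschke_unimodular p phi s h E); assumption.
Qed.
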